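(* Suppose that $\mu$ is basic. Then, for any $\lambda\in\mathbb{R}$, $\delta\in(0,1)$ and $\varepsilon>0$ there are $C,c\in(0,\infty)$ (depending on $\mu,\lambda,\delta,\varepsilon$) such that $$\mu\left(\omega:\left|\frac1n\log E_0^\omega\big[e^{\lambda Z_n}\big]-\mathcal{I}^*(\lambda)\right|>\varepsilon\right)\le C\,e^{-cn^{1-\delta}}\qquad\forall\,n\in\mathbb{N},$$ where $\mathcal{I}^*(\lambda)=\sup_{x\in\mathbb{R}}[\lambda x-\mathcal{I}(x)]$, $\lambda\in\mathbb{R}$, is the Legendre transform of the quenched rate function $\mathcal{I}=\mathcal{I}_\mu$ of the displacements $Z_n/n$.
   Context: Notation: $\mathbb{N}=\{1,2,\dots\}$, $\mathbb{N}_0=\mathbb{N}\cup\{0\}$. Basic law. Let $\alpha$ be a probability distribution on $(0,1)$ and $\mu=\alpha^{\mathbb{Z}}$, so that under $\mu$ the environment $\omega=(\omega(x))_{x\in\mathbb{Z}}$ is i.i.d. with marginal $\alpha$. Write $\rho=(1-\omega(0))/\omega(0)$. Such a $\mu$ is called basic if (i) (uniform ellipticity) the support of $\alpha$ is contained in $[\mathfrak{c},1-\mathfrak{c}]$ for some $\mathfrak{c}>0$; and (ii) (nestedness) $\rho_{\min}<1<\rho_{\max}$, where $\rho_{\min},\rho_{\max}$ are the minimum and maximum of $\rho$ over the support of $\alpha$. Random walk in (static) random environment. Given $\omega$, $Z=(Z_n)_{n\in\mathbb{N}_0}$ is the Markov chain on $\mathbb{Z}$ jumping from $x$ to $x+1$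 with probability $\omega(x)$ and to $x-1$ with probability $1-\omega(x)$; $P_0^\omega$ and $E_0^\omega$ denote its (quenched) law and expectation when $Z_0=0$. Quenched rate function. It is known (Greven and den Hollander) that if $\mu$ is basic, then there is a convex deterministic rate function $\mathcal{I}=\mathcal{I}_\mu:\mathbb{R}\to[0,\infty]$ such that, for $\mu$-a.e. $\omega$, $(Z_n/n)_{n\in\mathbb{N}}$ under $P_0^\omega$ satisfies the large deviation principle with rate $n$ and rate function $\mathcal{I}$: $\mathcal{I}$ has compact level sets, $\mathcal{I}\not\equiv\infty$, $\liminf_n\frac1n\log P_0^\omega(Z_n/n\in\mathcal{O})\ge-\inf_{\mathcal{O}}\mathcal{I}$ for $\mathcal{O}$ open, and $\limsup_n\frac1n\log P_0^\omega(Z_n/n\in\mathcal{C})\le-\inf_{\mathcal{C}}\mathcal{I}$ for $\mathcal{C}$ closed. This determines $\mathcal{I}$ uniquely. *)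

(* Defs.v *)
From HB Require Import structures.
From mathcomp Require Import all_boot all_order all_algebra.
From mathcomp Require Import all_classical all_reals all_analysis.

Set Implicit Arguments.
Unset Strict Implicit.
Unset Printing Implicit Defensive.

Import Order.TTheory GRing.Theory Num.Theory.
Import numFieldNormedType.Exports.

Local Open Scope classical_set_scope.
Local Open Scope ring_scope.

(* Environments are elements of R^Z with the product Borel sigma-algebra. *)
Definition coordinate_events (R : realType) : set (set (int -> R)) :=
  [set A | exists x : int, exists2 B : set (measurableTypeR R),
     measurable B & A = [set omega | B (omega x)]].

Definition env_space (R : realType) := g_sigma_algebraType (@coordinate_events R).

(* (0,1)^Z as a subset of R^Z. It has full measure under alpha^Z when alpha is
   carried by (0,1), and only on it is the walk required to be defined. *)
Definition is_env (R : realType) (omega : env_space R) : Prop :=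
  forall x : int, 0 < omega x < 1.

(* mu = alpha^Z: this determines mu, since the finite-dimensional rectangles
   form a generating pi-system. *)
Definition product_law (R : realType)
    (alpha : probability (measurableTypeR R) R)
    (mu : probability (env_space R) R) : Prop :=
  forall (s : seq int) (B : int -> set (measurableTypeR R)),
    uniq s -> (forall x, measurable (B x)) ->
    mu [set omega | forall x, x \in s -> B x (omega x)]
      = (\prod_(x <- s) alpha (B x))%E.

Definition msupport (R : realType)
    (alpha : probability (measurableTypeR R) R) : set R :=
  [set a | forall U : set R, open U -> U a -> (0 < alpha U)%E].

Definition rho (R : realType) (a : R) : R := (1 - a) / a.

(* Under uniform ellipticity the support is nonempty and compact and rho is
   continuous on it, so that inf and sup are the minimum and the maximum. *)
Definition rho_min (R : realType)
    (alpha : probability (measurableTypeR R) R) : R :=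
  inf (@rho R @` msupport alpha).

Definition rho_max (R : realType)
    (alpha : probability (measurableTypeR R) R) : R :=
  sup (@rho R @` msupport alpha).

Record basic (R : realType) (alpha : probability (measurableTypeR R) R)
    (mu : probability (env_space R) R) : Prop := Basic {
  basic_marginal : alpha (`]0, 1[%classic : set R) = 1%E ;
  basic_product : product_law alpha mu ;
  basic_elliptic :
    exists2 c : R, 0 < c & msupport alpha `<=` `[c, 1 - c]%classic ;
  basic_nested : rho_min alpha < 1 < rho_max alpha }.

(* g_sigma_algebraType requires a pointed carrier. *)
HB.instance Definition _ := isPointed.Build int 0.

(* Trajectories n |-> Z_n; Z is the coordinate process. *)
Definition path_events : set (set (nat -> int)) :=
  [set A | exists n : nat, exists x : int, A = [set z | z n = x]].

Definition path_space := g_sigma_algebraType path_events.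

Definition jump (R : realType) (omega : env_space R) (x y : int) : R :=
  if y == x + 1 then omega x else if y == x - 1 then 1 - omega x else 0.

(* P is the law P_0^omega; the Markov property is written multiplicatively, so
   that histories of probability zero need no separate treatment. *)
Definition quenched_law (R : realType) (omega : env_space R)
    (P : probability path_space R) : Prop :=
  P [set z | z 0%N = 0] = 1%E /\
  forall (n : nat) (x : nat -> int),
    P [set z | forall i, (i <= n.+1)%N -> z i = x i]
      = (P [set z | forall i, (i <= n)%N -> z i = x i]
         * (jump omega (x n) (x n.+1))%:E)%E.

(* Large deviation principle with rate n for the sequence of laws (nu n);
   lne 0 = -oo and the infimum over the empty set is +oo. *)
Record LDP (R : realType) (nu : nat -> set R -> \bar R) (I : R -> \bar R)
    : Prop := IsLDP {
  LDP_compact_level : forall a : R, compact [set x | (I x <= a%:E)%E] ;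
  LDP_proper : exists x, I x <> +oo%E ;
  LDP_lower : forall O : set R, open O ->
    (- ereal_inf (I @` O)
       <= limn_einf (fun n => (n%:R^-1)%:E * lne (nu n O)))%E ;
  LDP_upper : forall K : set R, closed K ->
    (limn_esup (fun n => (n%:R^-1)%:E * lne (nu n K))
       <= - ereal_inf (I @` K))%E }.

Definition velocity_law (R : realType) (P : probability path_space R)
    (n : nat) (A : set R) : \bar R :=
  P [set z | A ((z n)%:~R / n%:R)].

Record quenched_rate_function (R : realType) (mu : probability (env_space R) R)
    (P : env_space R -> probability path_space R) (I : R -> \bar R)
    : Prop := QuenchedRateFunction {
  rate_ge0 : forall x, (0 <= I x)%E ;
  rate_convex : forall x y t : R, 0 < t < 1 ->
    (I (t * x + (1 - t) * y)%R <= t%:E * I x + (1 - t)%:E * I y)%E ;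
  rate_LDP : {ae mu, forall omega, LDP (velocity_law (P omega)) I} }.

Definition legendre (R : realType) (I : R -> \bar R) (lambda : R) : \bar R :=
  ereal_sup (range (fun x : R => (lambda * x)%:E - I x)%E).

Definition log_mgf_rate (R : realType) (P : probability path_space R)
    (lambda : R) (n : nat) : \bar R :=
  ((n%:R^-1)%:E * lne ('E_P[fun z => expR (lambda * (z n)%:~R)]))%E.

(* Main.v *)
(* Write T f x = w x * f (x + 1) + (1 - w x) * f (x - 1) for the transition
   operator, so that E_0 (exp (lam * Z_n)) = (T^n e_lam) 0, and L for the value
   at lam of the Legendre transform. By Varadhan's lemma
   (1/n) log (T^n e_lam) 0 --> L almost surely, hence a site is typical (the
   estimate with exponent L holds up to a small error when the walk starts
   there, for all times in a fixed window) with probability as close to 1 as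
   desired. Typicality depends on finitely many neighbouring sites, so outside
   an event of exponentially small probability the atypical sites in [-n, n]
   have small density, and it remains to argue for a fixed environment with
   few atypical sites, say for lam > 0.
   - Lower bound, L > 0: typical sites give a gain that must come from moving to
     the right, while an atypical site is left by one step to the right, at
     bounded cost; as the exploration only moves right, each atypical site is
     paid for once.
   - Lower bound, small L: nestedness produces a trap of bounded size (drift
     towards its centre on both sides) near the origin, in which the walk can be
     kept at arbitrarily small exponential cost. This also yields L >= 0.
   - Upper bound: let r > L and let g be the positive solution of T g = e^r g
     vanishing far to the left. Across l sites from a typical site, g grows by
     at least the factor e^(th * l) with th close to lam, and g is nondecreasing
     elsewhere, so e_lam is dominated by 1 + g, up to a small exponential.
   The case lam < 0 follows by reflecting the environment. *)
Require Import Defs.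
From HB Require Import structures.
From mathcomp Require Import all_boot all_order all_algebra.
From mathcomp Require Import all_classical all_reals all_analysis measurable_realfun.
From mathcomp Require Import zify ring lra.

Set Implicit Arguments.
Unset Strict Implicit.
Unset Printing Implicit Defensive.

Import Order.TTheory GRing.Theory Num.Theory.
Import numFieldNormedType.Exports.

Local Open Scope classical_set_scope.
Local Open Scope ring_scope.

(** * Transition operator and traps *)

Section walk.
Context {R : realType}.
Implicit Types (w f g : int -> R) (lam : R) (x y : int) (k n : nat).

Definition step w f : int -> R :=
  fun x => w x * f (x + 1) + (1 - w x) * f (x - 1).

Lemma step_le w f g x : is_env w -> f (x + 1) <= g (x + 1) ->
  f (x - 1) <= g (x - 1) -> step w f x <= step w g x.
Proof.
move=> w01 f1 f2; have /andP[w0 w1] := w01 x.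
by rewrite lerD// ler_wpM2l// ?ltW// subr_gt0.
Qed.

(** In [k] steps the walk moves by at most [k], so test functions need only be compared on that ball
    around the start. *)
Lemma iter_step_le w f g k x : is_env w ->
  (forall y, (`|y - x| <= k)%N -> f y <= g y) ->
  iter k (step w) f x <= iter k (step w) g x.
Proof.
move=> w01; elim: k x => [|k ih] x fg /=; first by apply: fg; lia.
by apply: step_le => //; apply: ih => y yx; apply: fg; lia.
Qed.

Lemma iter_stepD w f g a b k x :
  iter k (step w) (fun y => a * f y + b * g y) x =
  a * iter k (step w) f x + b * iter k (step w) g x.
Proof.
elim: k x => //= k ih x; rewrite /step !ih; ring.
Qed.

Lemma iter_stepZ w f a k x :
  iter k (step w) (fun y => a * f y) x = a * iter k (step w) f x.
Proof. by elim: k x => //= k ih x; rewrite /step !ih; ring. Qed.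

Lemma iter_step_cst w a k x : iter k (step w) (fun=> a) x = a.
Proof. by elim: k x => //= k ih x; rewrite /step !ih; ring. Qed.

Lemma iter_step_ge0 w f k x : is_env w ->
  (forall y, (`|y - x| <= k)%N -> 0 <= f y) -> 0 <= iter k (step w) f x.
Proof.
by move=> w01 f0; rewrite -(iter_step_cst w 0 k x); apply: iter_step_le.
Qed.

(** Only the path making [k] steps to the right is kept. *)
Lemma iter_step_right w f c k x : is_env w -> 0 < c ->
  (forall y, c <= w y) -> (forall y, 0 <= f y) ->
  c ^+ k * f (x + k%:Z) <= iter k (step w) f x.
Proof.
move=> w01 c0 cw f0; elim: k x => [|k ih] x; first by rewrite mul1r addr0.
have fk0 y : 0 <= iter k (step w) f y by apply: iter_step_ge0.
have /andP[w0 w1] := w01 x.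
rewrite /= /step -[leLHS]addr0; apply: lerD; last first.
  by rewrite mulr_ge0 ?subr_ge0 ?(ltW w1).
rewrite exprS -mulrA; apply: ler_pM; rewrite ?mulr_ge0 ?exprn_ge0 ?(ltW c0)//.
by rewrite intS addrA; exact: ih.
Qed.

(* The quenched moment generating function of the displacement at time [n] of
   the walk started at [x]. *)
Definition mgf w lam n x : R :=
  iter n (step w) (fun y => expR (lam * (y - x)%:~R)) x.

Lemma mgfE w lam n x y :
  iter n (step w) (fun z => expR (lam * (z - y)%:~R)) x =
  expR (lam * (x - y)%:~R) * mgf w lam n x.
Proof.
rewrite /mgf -iter_stepZ; congr (iter n _ _ _); apply/funext => z.
by rewrite -expRD -mulrDr -intrD; congr (expR (_ * _%:~R)); ring.
Qed.

Lemma mgf_bounds w lam n x : is_env w ->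
  expR (- (`|lam| * n%:R)) <= mgf w lam n x <= expR (`|lam| * n%:R).
Proof.
move=> w01; rewrite -[X in X <= _ <= _](iter_step_cst w _ n x).
rewrite -[X in _ <= _ <= X](iter_step_cst w _ n x).
apply/andP; split; apply: iter_step_le => // y yx.
  rewrite ler_expR lerNl -mulrN; apply: le_trans (ler_norm _) _.
  rewrite normrM normrN ler_wpM2l//.
  by rewrite -intr_norm -abszE [leLHS](_ : _ = (`|y-x|%N)%:R)// ler_nat.
rewrite ler_expR; apply: le_trans (ler_norm _) _.
rewrite normrM ler_wpM2l//.
by rewrite -intr_norm -abszE [leLHS](_ : _ = (`|y-x|%N)%:R)// ler_nat.
Qed.

Lemma mgf_gt0 w lam n x : is_env w -> 0 < mgf w lam n x.
Proof.
by move=> /(mgf_bounds lam n x)/andP[+ _]; apply: lt_le_trans; exact: expR_gt0.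
Qed.

(** The odds of stepping away from [x] are at most [q] at every site other than [x] at distance less
    than [K]; the centre itself is left free. *)
Definition trap w q K x := forall i, (0 < i < K)%N ->
  w (x + i%:Z) * (1 + q) <= q /\ (1 - w (x - i%:Z)) * (1 + q) <= q.


(* Inside a trap, [1 - q ^+ d], where [d] is the distance to the boundary, is
   subharmonic except at the centre, where a factor [1 - q ^+ K.-1] is lost. The
   truncated subtraction makes it vanish outside the trap. *)
Definition trap_fun q K x y : R := 1 - q ^+ (K - `|y - x|)%N.

Lemma trap_fun_ge0 q K x y : 0 < q < 1 -> 0 <= trap_fun q K x y.
Proof.
by move=> /andP[q0 q1]; rewrite subr_ge0 exprn_ile1// ltW.
Qed.

Lemma step_trap_fun w q e K x y : is_env w -> 0 < q < 1 -> 0 < e < 1 ->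
  (0 < K)%N -> q ^+ K.-1 <= e -> trap w q K x ->
  (1 - e) * trap_fun q K x y <= step w (trap_fun q K x) y.
Proof.
move=> w01 q01 /andP[e0 e1] K0 qK wtrap.
have /andP[q0 q1] := q01.
have qle1 k : q ^+ k <= 1 by rewrite exprn_ile1// ltW.
have h0 z := trap_fun_ge0 K x z q01.
have /andP[w0 w1] := w01 y.
have [iK|iK] := leqP K `|y - x|.
  rewrite {1}/trap_fun (_ : (K - _ = 0)%N); last lia.
  by rewrite expr0 subrr mulr0 addr_ge0// mulr_ge0 ?h0 ?ltW// ?subr_gt0.
(* At the centre both neighbours are at distance one, so the step yields [1 - q ^+ K.-1], which is
   at least [1 - e]. *)
have [->|yj] := eqVneq y x.
  rewrite /step /trap_fun subrr addrAC subrr add0r addrAC subrr add0r subn0 /=.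
  rewrite subn1.
  have := qle1 K.
  have : 0 <= q ^+ K by rewrite exprn_ge0// ltW.
  have : 0 <= q ^+ K.-1 by rewrite exprn_ge0// ltW.
  nra.
have [m Em] : exists m, (K - `|y - x| = m.+1)%N.
  by exists (K - `|y - x|).-1; lia.
(* Off the centre, [q ^+ d] is harmonic when the outward probability is exactly [q / (1 + q)], and
   the trap makes that probability no larger. *)
apply: (@le_trans _ _ (trap_fun q K x y)); first by rewrite ler_piMl// gerBl ltW.
have qm : 0 <= q ^+ m by rewrite exprn_ge0// ltW.
rewrite /step /trap_fun Em.
have [jy|yj'] := ltP x y.
  have [] := wtrap `|y - x|%N; first lia.
  rewrite (_ : x + _ = y) => [+ _|]; last lia.
  rewrite (_ : (K - absz (y + 1 - x)%R)%N = m); last lia.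
  rewrite (_ : (K - absz (y - 1 - x)%R)%N = m.+2); last lia.
  move=> wq; rewrite !exprS -subr_ge0 [leRHS](_ : _ =
    q ^+ m * ((1 - q) * (q - w y * (1 + q)))); last ring.
  by rewrite !mulr_ge0 ?subr_ge0 ?(ltW q1).
have [] := wtrap `|y - x|%N; first lia.
rewrite (_ : x - _ = y) => [_|]; last lia.
rewrite (_ : (K - absz (y + 1 - x)%R)%N = m.+2); last lia.
rewrite (_ : (K - absz (y - 1 - x)%R)%N = m); last lia.
move=> wq; rewrite !exprS -subr_ge0 [leRHS](_ : _ =
  q ^+ m * ((1 - q) * (q - (1 - w y) * (1 + q)))); last ring.
by rewrite !mulr_ge0 ?subr_ge0 ?(ltW q1).
Qed.

Lemma iter_step_eigen_ge w f a k x : is_env w -> 0 <= a ->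
  (forall y, a * f y <= step w f y) -> a ^+ k * f x <= iter k (step w) f x.
Proof.
move=> w01 a0 af; elim: k x => [|k ih] x; first by rewrite mul1r.
apply: (@le_trans _ _ (a ^+ k * step w f x)).
  by rewrite exprSr -mulrA ler_wpM2l// exprn_ge0.
rewrite /= [leLHS](_ : _ = step w (fun y => a ^+ k * f y) x).
  by apply: step_le.
by rewrite /step; ring.
Qed.

(** The walk goes straight to the centre [j] and then stays in the trap, where the exponential is at
    least [expR (- (|lam| * (j + K)))]. This constant times [trap_fun], which vanishes outside, is a
    minorant; its value at the centre gives the factor [1 - q]. *)
Lemma mgf_trap w lam c q e K j n : is_env w -> 0 < c -> (forall x, c <= w x) ->
  0 < q < 1 -> 0 < e < 1 -> (0 < K)%N -> q ^+ K.-1 <= e ->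
  trap w q K j%:Z -> (j <= n)%N ->
  c ^+ j * (expR (- (`|lam| * (j + K)%:R)) * ((1 - e) ^+ (n - j) * (1 - q)))
    <= mgf w lam n 0.
Proof.
move=> w01 c0 cw q01 e01 K0 qK wtrap jn.
have h0 y := trap_fun_ge0 K j%:Z y q01.
have he y := @step_trap_fun w q e K j%:Z y w01 q01 e01 K0 qK wtrap.
have /andP[q0 q1] := q01; have /andP[e0 e1] := e01.
rewrite /mgf -[in leRHS](subnKC jn) iterD.
apply: le_trans; last first.
  apply: (@iter_step_right _ _ c) => // y.
  by apply: iter_step_ge0 => // z _; exact: expR_ge0.
rewrite add0r ler_wpM2l ?exprn_ge0 ?(ltW c0)//.
move: (n - j)%N => m {jn n}.
set A := expR _.
have A0 : 0 <= A by exact: expR_ge0.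
apply: (@le_trans _ _ (A * ((1 - e) ^+ m * trap_fun q K j%:Z j%:Z))).
  rewrite !ler_wpM2l ?exprn_ge0 ?subr_ge0 ?(ltW e1)//.
  rewrite /trap_fun lerB// subrr subn0.
  by case: K K0 {h0 he A A0 qK wtrap} => // k _; rewrite exprS ler_piMr ?exprn_ile1 ?ltW.
apply: (@le_trans _ _ (A * iter m (step w) (trap_fun q K j%:Z) j%:Z)).
  by rewrite ler_wpM2l// iter_step_eigen_ge// subr_ge0 ltW.
rewrite -iter_stepZ; apply: iter_step_le => // y _.
have [iK|iK] := leqP K `|y - j%:Z|.
  by rewrite /trap_fun (_ : (K - _ = 0)%N) ?expr0 ?subrr ?mulr0 ?expR_ge0//; lia.
apply: (@le_trans _ _ A).
  by rewrite ler_piMr// gerBl exprn_ge0// ltW.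
rewrite ler_expR lerNl -mulrN; apply: le_trans (ler_norm _) _.
rewrite normrM normrN ler_wpM2l//.
rewrite -intr_norm -abszE [leLHS](_ : _ = (`|y - 0|%N)%:R)// ler_nat; lia.
Qed.

End walk.

(** * Greedy lower and upper bounds *)

Section greedy_lower.
Context {R : realType}.
Implicit Types (w f g : int -> R) (lam : R) (x y : int) (k n : nat).

(** A good site is used for a run of [N] steps, after which only end points to its right are kept;
    the [+ 1] in the hypothesis pays for the others. A bad site is left by one step to the right,
    which costs [c] and a unit of time, whence [c * expR (- s)]. The factors [expR (- (s * N))] and
    [c ^+ N] cover the final incomplete run. *)
Lemma mgf_greedy_ge w lam c s N (bad : pred nat) n a : is_env w ->
  0 < c -> (forall x, c <= w x) -> 0 < lam -> 0 <= s -> (0 < N)%N ->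
  (forall i : nat, ~~ bad i -> expR (s * N%:R) + 1 <= mgf w lam N i%:Z) ->
  expR (s * (n%:R - N%:R)) * (c * expR (- s)) ^+ count bad (iota a n) * c ^+ N
    <= mgf w lam n a%:Z.
Proof.
move=> w01 c0 cw lam0 s0 N0 good.
have c1 : c <= 1 by apply: le_trans (cw 0) _; have /andP[_ /ltW] := w01 0.
set kap := c * _.
have kap0 : 0 <= kap by rewrite mulr_ge0 ?expR_ge0 ?ltW.
have kap1 : kap <= 1.
  by rewrite mulr_ile1 ?expR_ge0 ?(ltW c0)// -[leRHS]expR0 ler_expR oppr_le0.
elim/ltn_ind: n a => n ih a.
have [nN|Nn] := ltnP n N.
  have le1 : expR (s * (n%:R - N%:R)) * kap ^+ count bad (iota a n) <= 1.
    rewrite mulr_ile1 ?expR_ge0 ?exprn_ge0 ?exprn_ile1//.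
    by rewrite -[leRHS]expR0 ler_expR mulr_ge0_le0// subr_le0 ler_nat ltnW.
  apply: (@le_trans _ _ (c ^+ N)); first by rewrite ler_piMl// exprn_ge0// ltW.
  apply: (@le_trans _ _ (c ^+ n * 1)).
    by rewrite mulr1 ler_wiXn2l ?(ltW c0)// ltnW.
  apply: le_trans; last first.
    by apply: (@iter_step_right _ _ _ c) => // y; exact: expR_ge0.
  rewrite ler_wpM2l ?exprn_ge0 ?(ltW c0)// addrAC subrr add0r -[leLHS]expR0.
  by rewrite ler_expR mulr_ge0 ?(ltW lam0)// ler0z.
have [bada|gooda] := boolP (bad a).
  case: n Nn ih => [|n] Nn ih; first by move: Nn N0; case: (N).
  rewrite /mgf /= /step bada exprD expr1.
  apply: (@le_trans _ _ (w a%:Z *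
     iter n (step w) (fun y => expR (lam * (y - a%:Z)%:~R)) (a%:Z + 1))); last first.
    rewrite lerDl mulr_ge0//; first by have /andP[_ /ltW] := w01 a; rewrite subr_ge0.
    by apply: iter_step_ge0 => // y _; exact: expR_ge0.
  rewrite mgfE addrAC subrr add0r mulr1.
  have -> : a%:Z + 1 = a.+1%:Z by lia.
  have := ih n (ltnSn n) a.+1.
  set V := _ * c ^+ N => /(ler_wpM2l (ltW c0)).
  have -> : expR (s * (n.+1%:R - N%:R)) * (kap * kap ^+ count bad (iota a.+1 n)) * c ^+ N = c * V.
    rewrite /V [X in expR X * _](_ : _ = s * (n%:R - N%:R) + s); last first.
      by rewrite -natr1; ring.
    rewrite {1}/kap expRD expRN.
    by field; rewrite gt_eqF// expR_gt0.
  move=> /le_trans; apply; apply: ler_pM; rewrite ?(ltW c0) ?(ltW (mgf_gt0 _ _ _ _))//.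
  rewrite ler_peMl// ?(ltW (mgf_gt0 _ _ _ _))//.
  by rewrite -[leLHS]expR0 ler_expR ltW.
set V := expR (s * ((n - N)%N%:R - N%:R)) * kap ^+ count bad (iota a n) * c ^+ N.
have V0 : 0 <= V by rewrite !mulr_ge0 ?exprn_ge0 ?expR_ge0 ?(ltW c0).
have -> : expR (s * (n%:R - N%:R)) * kap ^+ count bad (iota a n) * c ^+ N =
    V * expR (s * N%:R).
  rewrite /V (natrB _ Nn) [X in expR X * _](_ : _ = s * (n%:R - N%:R - N%:R) + s * N%:R).
    by rewrite expRD; ring.
  by ring.
have := good _ gooda; rewrite -lerBrDr => /(ler_wpM2l V0) /le_trans; apply.
rewrite [in leRHS]/mgf -[in leRHS](subnKC Nn) iterD.
rewrite [leLHS](_ : _ = iter N (step w)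
  (fun y => V * expR (lam * (y - a%:Z)%:~R) + (- V) * 1) a%:Z); last first.
  by rewrite iter_stepD iter_step_cst /mgf; ring.
(* Sites to the left of [a] contribute nonpositively to the right-hand side, so
   the induction hypothesis is only needed to the right of [a]. *)
apply: iter_step_le => // y ya; rewrite mgfE.
have m0 k z := ltW (mgf_gt0 lam k z w01).
have [yle|ylt] := leP y a%:Z.
  apply: (@le_trans _ _ 0); last by rewrite mulr_ge0 ?expR_ge0.
  rewrite mulr1 subr_le0 ler_piMr// -[leRHS]expR0 ler_expR.
  by rewrite mulr_ge0_le0 ?(ltW lam0)// lerz0; lia.
have [m [Em m1 mN]] : exists m, [/\ y = (a + m)%:Z, (0 < m)%N & (m <= N)%N].
  by exists `|y - a%:Z|%N; split; lia.
apply: (@le_trans _ _ (V * expR (lam * (y - a%:Z)%:~R))).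
  by rewrite gerDl mulr1 oppr_le0.
rewrite mulrC ler_wpM2l ?expR_ge0// Em.
apply: le_trans (ih (n - N)%N _ (a + m)%N); last lia.
rewrite /V -!mulrA ler_wpM2l ?expR_ge0// ler_wpM2r ?exprn_ge0 ?(ltW c0)//.
rewrite ler_wiXn2l//.
(* As [0 < m <= N], the sites left to explore from [a + m] are among those counted from [a]. *)
have -> : iota a n = iota a m ++ iota (a + m) (n - N) ++ iota (a + m + (n - N)) (N - m).
  by rewrite -!iotaD; congr iota; lia.
by rewrite !count_cat; lia.
Qed.
End greedy_lower.

Section greedy_upper.
Context {R : realType}.
Implicit Types (w f g : int -> R) (lam r : R) (x y L : int) (k n : nat).

(* Solves the second-order recursion [step w g = expR r * g] to the right of
   [L], starting from [g (L - 1) = 0] and [g L = 1]. *)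
Lemma step_eigenfunction w r L : is_env w -> 0 <= r ->
  exists g : int -> R, [/\ forall x, 0 <= g x, forall x, L <= x -> 0 < g x,
    {homo g : x y / x <= y} & forall x, L <= x -> step w g x = expR r * g x].
Proof.
move=> w01 r0.
(* [next] is the eigenvalue equation at [L + j] solved for the value at [L + j + 1]; [G j] holds the
   values at [L + j - 1] and [L + j]. *)
pose next (j : nat) (u v : R) :=
  (expR r * v - (1 - w (L + j%:Z)) * u) / w (L + j%:Z).
pose G := fix G (j : nat) : R * R :=
  if j is i.+1 then ((G i).2, next i (G i).1 (G i).2) else (0, 1).
(* Since [expR r >= 1], nonnegative increments propagate to the right. *)
have G_mono j : [/\ 0 <= (G j).1, (G j).1 <= (G j).2 & 0 < (G j).2].
  elim: j => [|j [u0 uv v0]] /=; first by [].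
  have /andP[w0 w1] := w01 (L + j%:Z).
  suff uv' : (G j).2 <= next j (G j).1 (G j).2.
    by split => //; [exact: ltW|exact: lt_le_trans uv'].
  rewrite /next ler_pdivlMr//.
  have : 1 <= expR r by rewrite -[leLHS]expR0 ler_expR.
  move=> /(ler_wpM2r (ltW v0)).
  have : (1 - w (L + j%:Z)) * (G j).1 <= (1 - w (L + j%:Z)) * (G j).2.
    by rewrite ler_wpM2l// subr_ge0 ltW.
  nra.
pose g x := if x < L then 0 else (G `|x - L|%N).2.
have gS j : g (L + j%:Z) = (G j).2.
  rewrite /g ifF; last by lia.
  by congr (G _).2; lia.
have gP j : g (L + j%:Z - 1) = (G j).1.
  case: j => [|j]; first by rewrite /g ifT//; lia.
  by rewrite /= -gS; congr g; lia.
have g_succ x : g x <= g (x + 1).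
  have [xL|Lx] := ltP x L.
    rewrite {1}/g xL /g; case: ifP => // _.
    by have [_ _ /ltW] := G_mono (absz (x + 1 - L)%R).
  have -> : x = L + `|x - L|%N%:Z by lia.
  have [_ + _] := G_mono (absz (x - L)%R).+1.
  by rewrite -gP -gS; congr (g _ <= g _); lia.
exists g; split.
- by move=> x; rewrite /g; case: ifP => // _; have [_ _ /ltW] := G_mono `|x - L|%N.
- by move=> x Lx; rewrite /g ifF; [have [_ _] := G_mono `|x - L|%N|lia].
- move=> x y xy.
  have -> : y = x + `|y - x|%N%:Z by lia.
  elim: `|y - x|%N => [|k ih]; first by rewrite addr0.
  by apply: le_trans ih _; rewrite (_ : x + k.+1%:Z = x + k%:Z + 1) ?g_succ//; lia.
- move=> x Lx.
  have -> : x = L + `|x - L|%N%:Z by lia.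
  move: `|x - L|%N => j; rewrite /step gP gS.
  have -> : L + j%:Z + 1 = L + j.+1%:Z by lia.
  rewrite gS /= /next.
  by have /andP[/lt0r_neq0 w0 _] := w01 (L + j%:Z); field.
Qed.

(** The margin [k] keeps each of the [k] steps inside the region where the equation holds. *)
Lemma iter_step_eigen w g r L k x :
  (forall x, L <= x -> step w g x = expR r * g x) -> L + k%:Z <= x ->
  iter k (step w) g x = expR r ^+ k * g x.
Proof.
move=> gE; elim: k x => [|k ih] x Lx /=; first by rewrite mul1r.
rewrite {1}/step !ih; [|lia|lia].
by rewrite exprSr -mulrA -gE; [rewrite /step; ring|lia].
Qed.

Lemma step_sum w (phi : nat -> int -> R) a b k x :
  step w (fun y => a * (\sum_(i < k) phi i y) + b) x =
  a * (\sum_(i < k) step w (phi i) x) + b.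
Proof.
rewrite /step big_split /= -!mulr_sumr; ring.
Qed.

(* Stop the walk on reaching [a + l] or at time [M]: on the first event the
   exponential at [a + l], which is [expR (lam * l)], bounds the stopped value by
   the resolvent; the second one costs at most [expR (- r) ^+ M]. *)
Lemma eigen_le_resolvent w lam r g L (M l : nat) a : is_env w -> 0 <= r ->
  (forall x, 0 <= g x) -> {homo g : x y / x <= y} ->
  (forall x, L <= x -> step w g x = expR r * g x) -> L + M%:Z <= a ->
  g a <= (expR (- (lam * l%:R)) * (\sum_(k < M) expR (- r) ^+ k * mgf w lam k a)
           + expR (- r) ^+ M) * g (a + l%:Z).
Proof.
move=> w01 r0 g0 g_mono gE La.
pose u k := iter k (step w) (fun y => expR (lam * (y - a)%:~R)).
have u0 k y : 0 <= u k y by apply: iter_step_ge0 => // z _; exact: expR_ge0.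
(* The induction on [M] needs the start to vary up to [a + l], while the exponential stays centred
   at [a]. *)
pose H M x := expR (- (lam * l%:R)) * (\sum_(k < M) expR (- r) ^+ k * u k x)
           + expR (- r) ^+ M.
suff: forall x, x <= a + l%:Z -> L + M%:Z <= x -> g x <= H M x * g (a + l%:Z).
  by apply => //; lia.
have er0 : 0 <= expR (- r) by exact: expR_ge0.
elim: M {La} => [|M ih] x xal Lx.
  by rewrite /H big_ord0 mulr0 add0r expr0 mul1r g_mono.
(* At the target the term [k = 0] alone cancels the prefactor, so [H] is at least one there. *)
have [->|xal'] := eqVneq x (a + l%:Z).
  rewrite ler_peMl// /H big_ord_recl mulrDr expr0 mul1r.
  have -> : u 0%N (a + l%:Z) = expR (lam * l%:R) by rewrite /u /= addrAC subrr add0r.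
  rewrite -expRD addNr expR0 -addrA lerDl addr_ge0 ?exprn_ge0//.
  by apply: mulr_ge0 => //; apply: sumr_ge0 => i _; rewrite mulr_ge0 ?exprn_ge0.
have -> : g x = expR (- r) * step w g x.
  rewrite gE; last lia.
  by rewrite mulrA -expRD addNr expR0 mul1r.
apply: (@le_trans _ _ (expR (- r) * step w (fun y => H M y * g (a + l%:Z)) x)).
  by rewrite ler_wpM2l//; apply: step_le => //; apply: ih; lia.
rewrite [X in _ * X <= _](_ : _ = step w (H M) x * g (a + l%:Z)); last first.
  by rewrite /step; ring.
rewrite mulrA ler_wpM2r// (step_sum w (fun k y => expR (- r) ^+ k * u k y)).
rewrite mulrDr -exprS lerD2r.
rewrite big_ord_recl mulrCA mulr_sumr ler_wpM2l ?expR_ge0// -[leLHS]add0r lerD//.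
  by rewrite mulr_ge0 ?exprn_ge0.
by apply: ler_sum => i _; rewrite /step exprS /u /= /step; lra.
Qed.

(** From a good site the exploration jumps [l] ahead and gains the full factor; from a bad one it
    advances by one without gain. The losses are one factor [expR th] per bad site and at most
    [expR (th * l)] for the last incomplete block. *)
Lemma greedy_growth g th (l : nat) (bad : pred nat) n (a : nat) : 0 <= th ->
  (0 < l)%N -> (forall x, 0 <= g x) -> {homo g : x y / x <= y} ->
  (forall i : nat, (a <= i)%N -> ~~ bad i -> g i%:Z * expR (th * l%:R) <= g (i + l)%N%:Z) ->
  g a%:Z * expR (th * (n%:R - l%:R - (count bad (iota a n))%:R)) <= g (a + n)%N%:Z.
Proof.
move=> th0 l0 g0 g_mono.
elim/ltn_ind: n a => n ih a good.
have [nl|ln] := ltnP n l.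
  apply: (@le_trans _ _ (g a%:Z)); last by apply: g_mono; lia.
  rewrite ler_piMr// -[leRHS]expR0 ler_expR mulr_ge0_le0//.
  rewrite -addrA -opprD subr_le0 -natrD ler_nat; lia.
have [bada|gooda] := boolP (bad a).
  case: n ln ih => [|n] ln ih; first by move: ln l0; case: (l).
  have := ih n (ltnSn n) a.+1 _; rewrite addSnnS.
  have good' i : (a.+1 <= i)%N -> ~~ bad i ->
      g i%:Z * expR (th * l%:R) <= g (i + l)%N%:Z.
    by move=> ai; apply: good; exact: ltnW.
  move=> /(_ good') /(le_trans _); apply.
  rewrite /= bada natrD -natr1.
  rewrite (_ : n%:R + 1 - l%:R - (1 + (count bad (iota a.+1 n))%:R) =
    n%:R - l%:R - (count bad (iota a.+1 n))%:R); last by ring.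
  by rewrite ler_wpM2r ?expR_ge0// g_mono//; lia.
have := ih (n - l)%N _ (a + l)%N _; rewrite -addnA subnKC//.
have nl : (n - l < n)%N by lia.
have good' i : (a + l <= i)%N -> ~~ bad i ->
    g i%:Z * expR (th * l%:R) <= g (i + l)%N%:Z.
  by move=> ai; apply: good; lia.
move=> /(_ nl good') /(le_trans _); apply.
apply: (@le_trans _ _ (g a%:Z * expR (th * l%:R) *
    expR (th * ((n - l)%:R - l%:R - (count bad (iota (a + l) (n - l)))%:R)))); last first.
  by rewrite ler_wpM2r ?expR_ge0// good.
rewrite -mulrA ler_wpM2l// -expRD ler_expR -mulrDr ler_wpM2l// natrB//.
have : (count bad (iota (a + l) (n - l)) <= count bad (iota a n))%N.
  have -> : iota a n = iota a l ++ iota (a + l) (n - l).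
    by rewrite -iotaD subnKC.
  by rewrite count_cat leq_addl.
by rewrite -(ler_nat R); lra.
Qed.

(** On the sites reachable by time [n], the exponential is dominated by [D * (1 + g / g 0)]: the
    constant suffices on the left, the growth of [g] on the right. Under [n] steps the constant is
    invariant and [g] is multiplied by [expR r ^+ n]. *)
Lemma mgf_greedy_le w lam r th S (M l : nat) (bad : pred nat) n : is_env w ->
  0 <= r -> 0 <= th <= lam -> (0 < l)%N ->
  expR (- (lam * l%:R)) * S + expR (- r) ^+ M <= expR (- (th * l%:R)) ->
  (forall i : nat, ~~ bad i ->
    \sum_(k < M) expR (- r) ^+ k * mgf w lam k i%:Z <= S) ->
  mgf w lam n 0 <= 2 * expR (r * n%:R + (lam - th) * n%:R
                      + th * (l%:R + (count bad (iota 0 n))%:R)).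
Proof.
move=> w01 r0 /andP[th0 thlam] l0 Sth good.
(* The margin [n] keeps the walk from the origin where the eigenvalue equation holds; the margin [M]
   leaves room for the stopping argument at every [i >= 0]. *)
pose L := - (n + M)%:Z.
have [g [g0 gpos g_mono gE]] := step_eigenfunction L w01 r0.
have gpos0 : 0 < g 0 by apply: gpos; lia.
have growth (m : nat) := @greedy_growth g th l bad m 0 th0 l0 g0 g_mono.
have {}growth (m : nat) :
    g 0 * expR (th * (m%:R - l%:R - (count bad (iota 0 m))%:R)) <= g m%:Z.
  apply: growth => i _ goodi.
  have La : L + M%:Z <= i%:Z by lia.
  have := @eigen_le_resolvent w lam r g L M l i%:Z w01 r0 g0 g_mono gE La.
  set B := (X in _ <= X * _) => gB.
  have {}gB : g i%:Z <= expR (- (th * l%:R)) * g (i%:Z + l%:Z).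
    apply: le_trans gB _; rewrite ler_wpM2r//.
    apply: le_trans Sth; rewrite lerD2r ler_wpM2l ?expR_ge0//.
    exact: good.
  have := ler_wpM2r (expR_ge0 (th * l%:R)) gB => /le_trans; apply.
  by rewrite mulrAC -expRD addNr expR0 mul1r.
set b := count bad (iota 0 n).
(* [D] absorbs the deficit [lam - th] over at most [n] sites, the last incomplete block and the bad
   sites. *)
pose D := expR ((lam - th) * n%:R + th * (l%:R + b%:R)).
have D1 : 1 <= D.
  by rewrite -[leLHS]expR0 ler_expR addr_ge0// mulr_ge0 ?subr_ge0.
apply: (@le_trans _ _ (iter n (step w) (fun y => D * 1 + (D / g 0) * g y) 0)).
  apply: iter_step_le => // y yn; rewrite subr0.
  have [y0|y0] := ltP y 0.
    apply: (@le_trans _ _ 1).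
      rewrite -[leRHS]expR0 ler_expR mulr_ge0_le0 ?(le_trans th0)// lerz0; lia.
    by rewrite mulr1 ler_wpDr// mulr_ge0// divr_ge0 ?expR_ge0// ltW.
  rewrite -[leLHS]add0r lerD ?mulr1 ?expR_ge0//.
  rewrite mulrAC ler_pdivlMr//.
  have -> : y = `|y|%N%:Z by lia.
  apply: le_trans (ler_wpM2l (expR_ge0 _) (growth `|y|%N)).
  rewrite mulrCA [leLHS]mulrC ler_wpM2l// -expRD ler_expR.
  have bb : ((count bad (iota 0 `|y|%N))%:R <= b%:R :> R).
    rewrite ler_nat /b.
    have -> : iota 0 n = iota 0 `|y|%N ++ iota (0 + `|y|%N) (n - `|y|%N).
      by rewrite -iotaD; congr iota; lia.
    by rewrite count_cat leq_addr.
  have yn' : (`|y|%N%:R <= n%:R :> R) by rewrite ler_nat; lia.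
  have -> : (`|y|%N%:Z)%:~R = `|y|%N%:R :> R by [].
  have : 0 <= (lam - th) * (n%:R - `|y|%N%:R) by rewrite mulr_ge0 ?subr_ge0.
  have : 0 <= th * (b%:R - (count bad (iota 0 `|y|%N))%:R).
    by rewrite mulr_ge0 ?subr_ge0.
  by lra.
rewrite iter_stepD iter_step_cst (iter_step_eigen gE); last lia.
rewrite mulr1 mulrCA mulrAC -mulrA divff ?gt_eqF// mulr1.
rewrite -addrA expRD -/b -/D expRM_natr mulr2n mulrDl mul1r lerD//.
by rewrite ler_peMl ?(le_trans ler01)// exprn_ege1// -[leLHS]expR0 ler_expR.
Qed.
End greedy_upper.

(** * Quenched expectations *)

Section path_expectation.
Context {R : realType} (P : probability path_space R).
Implicit Types (w f : int -> R) (z : path_space) (n k : nat).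

Definition cylinder n (x : nat -> int) : set path_space :=
  [set z | forall i, (i <= n)%N -> z i = x i].

Lemma measurable_coord n (x : int) : measurable ([set z | z n = x] : set path_space).
Proof. by apply: sub_sigma_algebra; exists n, x. Qed.

Lemma measurable_coord_fun f n : measurable_fun setT (fun z : path_space => f (z n)).
Proof.
move=> _ B mB; rewrite setTI.
have -> : (fun z : path_space => f (z n)) @^-1` B =
    \bigcup_x (if `[< B (f x) >] then [set z : path_space | z n = x] else set0).
  apply/seteqP; split => [z Bz|z [x _]].
    by exists (z n) => //; rewrite asboolT.
  by case: asboolP => // Bx /= ->.
apply: countable_bigcupT_measurable => [|x]; first exact: countableP.
by case: ifP => // _; exact: measurable_coord.
Qed.

Lemma measurable_cylinder n x : measurable (cylinder n x).
Proof.
rewrite [cylinder n x](_ : _ = \bigcap_(i in [set i | (i <= n)%N])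
    [set z : path_space | z i = x i]).
  by apply: bigcap_measurableType => i _; exact: measurable_coord.
by [].
Qed.

Local Notation extend x n y := (fun i => if (i <= n)%N then x i else y).

Lemma cylinder_extend n x y :
  cylinder n.+1 (extend x n y) = cylinder n x `&` [set z | z n.+1 = y].
Proof.
apply/seteqP; split => [z zx|z [zx zy] i /=].
  split => [i ni|/=]; first by rewrite zx ?(leqW ni)// ni.
  by rewrite zx// ltnn.
by rewrite leq_eqVlt => /predU1P[->|]; [rewrite ltnn|rewrite ltnS => ni; rewrite ni zx].
Qed.

(** The Markov property at a fixed time, by induction on [k] over all cylinders at once. *)
Lemma integral_cylinder w f k n x : is_env w -> quenched_law w P ->
  (forall y, 0 <= f y) ->
  (\int[P]_(z in cylinder n x) (f (z (n + k)%N))%:E =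
   P (cylinder n x) * (iter k (step w) f (x n))%:E)%E.
Proof.
move=> w01 [_ Pstep] f0; elim: k n x => [|k ih] n x.
  rewrite (eq_integral (cst (f (x n))%:E)) => [|z]; last first.
    by rewrite inE addn0 => zx; rewrite zx.
  rewrite integral_cst; last exact: measurable_cylinder.
  by rewrite muleC.
(* No Markov property on null events is needed: the two nearest-neighbour
   extensions of a cylinder already carry its full mass. *)
pose C y := cylinder n.+1 (extend x n y).
have mC y : measurable (C y) by exact: measurable_cylinder.
have PC y : P (C y) = (P (cylinder n x) * (jump w (x n) y)%:E)%E.
  rewrite [LHS]Pstep leqnn ltnn; congr (P _ * _)%E.
  by apply/seteqP; split => z zx i ni; have := zx i ni; rewrite ni.
have CC : [disjoint C (x n + 1) & C (x n - 1)].
  apply/disj_setPS => z; rewrite /C !cylinder_extend => -[[_ /= ->] [_ /=]].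
  by move=> ?; lia.
have CU : C (x n + 1) `|` C (x n - 1) `<=` cylinder n x.
  by rewrite /C !cylinder_extend => z [[]|[]].
have mfk (D : set path_space) :
    measurable_fun D (EFin \o (fun z : path_space => f (z (n + k.+1)%N))).
  by apply/measurable_EFinP; apply: measurable_funTS; exact: measurable_coord_fun.
have /andP[w0 w1] := w01 (x n).
have PU : P (C (x n + 1) `|` C (x n - 1)) = P (cylinder n x).
  rewrite measureU//=; last by apply/disj_set2P.
  rewrite !PC -ge0_muleDr ?lee_fin; last 2 first.
  - by rewrite /jump eqxx ltW.
  - by rewrite /jump ifF ?eqxx ?subr_ge0 ?ltW//; lia.
  rewrite -EFinD /jump eqxx ifF; last lia.
  by rewrite eqxx addrC subrK mule1.
have -> : (\int[P]_(z in cylinder n x) (f (z (n + k.+1)%N))%:E =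
    \int[P]_(z in C (x n + 1)%R `|` C (x n - 1)%R) (f (z (n + k.+1)%N))%:E)%E.
  rewrite (@ge0_negligible_integral _ _ _ _ (cylinder n x)
    (cylinder n x `\` (C (x n + 1) `|` C (x n - 1))))//.
  - by rewrite setDD setIidr.
  - by apply: measurableD; [exact: measurable_cylinder|exact: measurableU].
  - exact: measurable_cylinder.
  - by move=> z _; rewrite lee_fin.
  - rewrite measureD ?setIidr//.
    + by rewrite /= PU subee// fin_num_measure//; exact: measurable_cylinder.
    + exact: measurable_cylinder.
    + exact: measurableU.
    + by rewrite ltey_eq fin_num_measure//; exact: measurable_cylinder.
rewrite ge0_integral_setU//; last by move=> z _; rewrite lee_fin.
rewrite addnS -addSn !ih// -/(C _) -/(C _) !PC.
rewrite ltnn -!muleA -!EFinM -ge0_muleDr ?lee_fin; last 2 first.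
- by rewrite /jump eqxx mulr_ge0 ?(ltW w0)// iter_step_ge0.
- by rewrite /jump ifF ?eqxx ?mulr_ge0 ?subr_ge0 ?(ltW w1) ?iter_step_ge0//; lia.
rewrite -EFinD /jump eqxx ifF; last lia.
by rewrite eqxx.
Qed.

Lemma integral_path w f n : is_env w -> quenched_law w P ->
  (forall y, 0 <= f y) ->
  (\int[P]_z (f (z n))%:E = (iter n (step w) f 0)%:E)%E.
Proof.
move=> w01 qP f0; have [P0 _] := qP.
have mC : measurable (cylinder 0 (fun=> 0)) by exact: measurable_cylinder.
have PC : P (cylinder 0 (fun=> 0)) = 1%E.
  rewrite -P0; congr (P _); apply/seteqP; split => [z|z /= z0 i].
    by apply.
  by rewrite leqn0 => /eqP ->.
have := @integral_cylinder w f n 0 (fun=> 0) w01 qP f0.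
rewrite PC mul1e => <-.
rewrite (@ge0_negligible_integral _ _ _ _ setT (~` (cylinder 0 (fun=> 0))))//.
- by rewrite setTD setCK.
- exact: measurableC.
- by apply/measurable_EFinP; exact: measurable_coord_fun.
- by move=> z _; rewrite lee_fin.
- by have := probability_setC P mC; rewrite PC subee.
Qed.

Lemma log_mgf_rateE w lam n : is_env w -> quenched_law w P ->
  log_mgf_rate P lam n = (ln (mgf w lam n 0) / n%:R)%:E.
Proof.
move=> w01 qP; rewrite /log_mgf_rate unlock.
rewrite (@integral_path w (fun y => expR (lam * y%:~R)))//.
have -> : iter n (step w) (fun y => expR (lam * y%:~R)) 0 = mgf w lam n 0.
  by rewrite /mgf; congr (iter n _ _ _); apply/funext => y; rewrite subr0.
by rewrite lne_EFin ?mgf_gt0// -EFinM mulrC.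
Qed.

Lemma velocity_lawE w n (A : set R) : is_env w -> quenched_law w P ->
  velocity_law P n A =
  (iter n (step w) (fun y => if `[< A (y%:~R / n%:R) >] then 1 else 0) 0)%:E.
Proof.
move=> w01 qP.
pose f (y : int) : R := if `[< A (y%:~R / n%:R) >] then 1 else 0.
pose S := [set z : path_space | A ((z n)%:~R / n%:R)].
have f1 z : f (z n) = \1_S z.
  rewrite /f indicE; case: asboolP => [Sz|Sz]; first by rewrite mem_set.
  by rewrite memNset.
have mS : measurable S.
  rewrite [S](_ : _ = setT `&` (fun z : path_space => f (z n)) @^-1` [set 1]).
    exact: (measurable_coord_fun f n measurableT).
  rewrite setTI; apply/seteqP; split => z /=; rewrite f1 indicE.
    by move=> Sz; rewrite mem_set.
  by move=> /eqP; rewrite pnatr_eq1 eqb1 inE.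
rewrite -integral_path//; last by move=> y; case: ifP.
rewrite /velocity_law -/S -[S]setIT -integral_indic//.
by apply: eq_integral => z _; rewrite -f1.
Qed.

End path_expectation.

(** * Varadhan's lemma *)

(** The estimate that defines a typical site, for one time and one starting point. *)
Definition tight {R : realType} (w : int -> R) (lam L e : R) n x :=
  expR ((L - e) * n%:R) <= mgf w lam n x <= expR ((L + e) * n%:R).

Section varadhan.
Context {R : realType}.
Implicit Types (w : int -> R) (lam : R) (n : nat).

Lemma limn_esup_lt (u : (\bar R)^nat) b : (limn_esup u < b)%E ->
  \forall n \near \oo, (u n < b)%E.
Proof.
move=> /ereal_inf_lt[_ [V nV <-] Vb].
apply: filterS nV => n Vn; apply: le_lt_trans Vb.
by apply: ereal_sup_ubound; exists n.
Qed.

Lemma limn_einf_gt (u : (\bar R)^nat) b : (b < limn_einf u)%E ->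
  \forall n \near \oo, (b < u n)%E.
Proof.
rewrite /limn_einf lteNr => /limn_esup_lt; apply: filterS => n.
by rewrite lteNl oppeK.
Qed.

Definition walk_prob w n (A : set R) : R :=
  iter n (step w) (fun y => if `[< A (y%:~R / n%:R) >] then 1 else 0) 0.

Lemma LDP_upper_near w P I (K : set R) b : is_env w -> quenched_law w P ->
  LDP (velocity_law P) I -> closed K -> (forall x, K x -> (- b%:E <= I x)%E) ->
  forall e, 0 < e -> \forall n \near \oo, walk_prob w n K <= expR ((b + e) * n%:R).
Proof.
move=> w01 qP LP cK IK e e0.
have : (limn_esup (fun n => (n%:R^-1)%:E * lne (velocity_law P n K)) < (b + e)%:E)%E.
  apply: le_lt_trans (LDP_upper LP cK) _; rewrite lteNl.
  apply: (@lt_le_trans _ _ (- b%:E)%E); first by rewrite -EFinN lte_fin ltrN2 ltrDl.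
  by apply: le_ereal_inf_tmp => _ [x Kx <-]; exact: IK.
move=> /limn_esup_lt[N _ HN]; exists N.+1 => // n /= Nn; have := HN n (ltnW Nn).
rewrite (@velocity_lawE _ P w n K w01 qP) -/(walk_prob w n K).
have [p0 _|p0] := leP (walk_prob w n K) 0; first by rewrite (le_trans p0) ?expR_ge0.
rewrite lne_EFin// -EFinM lte_fin mulrC ltr_pdivrMr ?ltr0n ?(leq_trans _ Nn)//.
by rewrite -[X in _ -> X <= _]lnK// ler_expR => /ltW.
Qed.

Lemma LDP_lower_near w P I (O : set R) x b : is_env w -> quenched_law w P ->
  LDP (velocity_law P) I -> open O -> O x -> I x = b%:E ->
  forall e, 0 < e -> \forall n \near \oo, expR (- (b + e) * n%:R) <= walk_prob w n O.
Proof.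
move=> w01 qP LP oO Ox Ix e e0.
have : (- (b + e)%:E < limn_einf (fun n => (n%:R^-1)%:E * lne (velocity_law P n O)))%E.
  apply: lt_le_trans (LDP_lower LP oO); rewrite lteN2.
  apply: (@le_lt_trans _ _ (I x)); first by apply: ereal_inf_lbound; exists x.
  by rewrite Ix lte_fin ltrDl.
move=> /limn_einf_gt[N _ HN]; exists N.+1 => // n /= Nn; have := HN n (ltnW Nn).
have n0 : (0 < n)%N by exact: leq_trans Nn.
rewrite (@velocity_lawE _ P w n O w01 qP) -/(walk_prob w n O).
have [p0|p0] := leP (walk_prob w n O) 0.
  by rewrite le0_lneNy ?lee_fin// gt0_muleNy ?lte_fin ?invr_gt0 ?ltr0n.
rewrite lne_EFin// -EFinM -EFinN lte_fin mulrC ltr_pdivlMr ?ltr0n//.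
by rewrite -[X in _ -> _ <= X]lnK// ler_expR => /ltW.
Qed.

Lemma iter_step_sum w (J : nat) (a : nat -> R) (f : nat -> int -> R) k x :
  iter k (step w) (fun y => \sum_(j < J) a j * f j y) x =
  \sum_(j < J) a j * iter k (step w) (f j) x.
Proof.
elim: J => [|J ih].
  under eq_fun do rewrite big_ord0.
  by rewrite iter_step_cst big_ord0.
under eq_fun do rewrite big_ord_recr /= -[X in X + _]mul1r.
by rewrite iter_stepD ih big_ord_recr /= mul1r.
Qed.

Lemma near_all_ord (J : nat) (Q : nat -> nat -> Prop) :
  (forall j, (j < J)%N -> \forall n \near \oo, Q j n) ->
  \forall n \near \oo, forall j, (j < J)%N -> Q j n.
Proof.
elim: J => [|J ih] HQ; first by near=> n.
have HJ := HQ J (ltnSn J).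
have {}ih := ih (fun j jJ => HQ j (ltnW jJ)).
by apply: filterS2 HJ ih => n QJ Qj j; rewrite ltnS leq_eqVlt => /predU1P[->|/Qj].
Unshelve. all: by end_near. Qed.

Lemma near_le_exp (c e : R) : 0 < e -> \forall n \near \oo, c <= expR (e * n%:R).
Proof.
move=> e0; exists (Num.truncn (c / e)).+1 => // n /= Hn.
apply: (@le_trans _ _ (e * n%:R)); last by apply: le_trans (expR_ge1Dx _); rewrite lerDr.
rewrite mulrC -ler_pdivrMr//; apply: le_trans (ltW (truncnS_gt _)) _.
by rewrite ler_nat.
Qed.

(** Velocities lie in [[-1, 1]], which is cut into [2 * J] closed cells on which [lam * x] varies by
    at most [e / 4]; on each cell [I x >= lam * x - L] bounds the probability. The variation costs
    [2 * (e / 4)], the large deviation bound [e / 4], and the number of cells the last [e / 4]. *)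
Lemma varadhan_upper w P I lam L : is_env w -> quenched_law w P ->
  LDP (velocity_law P) I -> (forall x, (0 <= I x)%E) -> (legendre I lam <= L%:E)%E ->
  forall e, 0 < e -> \forall n \near \oo, mgf w lam n 0 <= expR ((L + e) * n%:R).
Proof.
move=> w01 qP LP I0 IL e e0.
pose J := (Num.truncn (`|lam| / (e / 4))).+1.
have J0 : (0 < J%:R :> R) by rewrite ltr0n.
have lamJ : `|lam| / J%:R <= e / 4.
  rewrite ler_pdivrMr// mulrC -ler_pdivrMr ?divr_gt0// ltW//; exact: truncnS_gt.
pose pt (j : nat) : R := -1 + j%:R / J%:R.
pose K (j : nat) := [set x : R | pt j <= x <= pt j + J%:R^-1].
pose m j := lam * pt j + `|lam| / J%:R.
have Km j x : K j x -> m j - `|lam| / J%:R - `|lam| / J%:R <= lam * x <= m j.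
  move=> /andP[x1 x2]; rewrite /m addrK.
  have : `|lam * (x - pt j)| <= `|lam| / J%:R.
    by rewrite normrM ler_wpM2l// ger0_norm ?subr_ge0// lerBlDl.
  by rewrite mulrBr ler_norml; lra.
have cK j : closed (K j).
  have -> : K j = `[pt j, pt j + J%:R^-1]%classic by apply/seteqP; split=> x /=; rewrite in_itv.
  exact: itv_closed.
have /near_all_ord HKall : forall j, (j < 2 * J)%N -> \forall n \near \oo,
    walk_prob w n (K j) <= expR ((L - m j + 2 * (`|lam| / J%:R) + e / 4) * n%:R).
  move=> j _; apply: (@LDP_upper_near w P I) => //; last by rewrite divr_gt0.
  move=> x Kx; have /andP[h1 h2] := Km j x Kx.
  have : ((lam * x)%:E - I x <= L%:E)%E.
    by apply: le_trans IL; apply: ereal_sup_ubound; exists x.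
  have := I0 x; case: (I x) => [i _| _ _|//]; last by rewrite leey.
  rewrite -EFinB -EFinN !lee_fin; lra.
have HC := @near_le_exp (2 * J)%:R (e / 4) (divr_gt0 e0 (ltr0n _ 4)).
apply: filterS2 HC HKall => n nJ HK; have [->|n0] := posnP n.
  by rewrite /mgf /= subrr !mulr0.
have n0R : (0 < n%:R :> R) by rewrite ltr0n.
apply: (@le_trans _ _ (iter n (step w) (fun y => \sum_(j < 2 * J)
   expR (m j * n%:R) * (if `[< K j (y%:~R / n%:R) >] then 1 else 0)) 0)).
  apply: iter_step_le => // y yn; rewrite subr0.
  have yn1 : -1 <= (y%:~R / n%:R : R) <= 1.
    apply/andP; rewrite ler_pdivlMr// ler_pdivrMr// mulN1r mul1r; apply/andP.
    by rewrite (_ : n%:R = n%:Z%:~R)// -rmorphN !ler_int; lia.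
  have [j jJ Kj] : exists2 j, (j < 2 * J)%N & K j (y%:~R / n%:R).
    set x := _ / _ in yn1 *; have /andP[x1 x2] := yn1.
    (* Truncation would give the index [2 * J] at the right end point, which belongs to the last
       cell instead. *)
    have [x1'|x1'] := eqVneq x 1.
      exists (2 * J).-1; first by rewrite prednK// muln_gt0.
      have -> : K (2 * J).-1 = [set x | 1 - J%:R^-1 <= x <= 1].
        have ptE : pt (2 * J).-1 = 1 - J%:R^-1.
          rewrite /pt -subn1 natrB ?muln_gt0// natrM.
          by field; rewrite gt_eqF.
        by rewrite /K ptE subrK.
      by rewrite /= x1' lexx andbT gerBl invr_ge0 ltW.
    have x1J : 0 <= (x + 1) * J%:R by rewrite mulr_ge0 ?ler0n// -lerBlDr sub0r.
    exists (Num.truncn ((x + 1) * J%:R)).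
      rewrite truncn_lt_nat// natrM ltr_pM2r//.
      by have : x < 1 by [rewrite lt_neqAle x1'|]; lra.
    have /andP[] := truncn_itv x1J; set t := Num.truncn _.
    rewrite -ler_pdivrMr// -ltr_pdivlMr// -natr1 mulrDl mul1r /K /pt /=; lra.
  have [h1 h2] := andP (Km _ _ Kj).
  rewrite (bigD1 (Ordinal jJ))//= asboolT// mulr1 ler_wpDr//.
    by apply: sumr_ge0 => i _; rewrite mulr_ge0 ?expR_ge0//; case: ifP.
  by rewrite ler_expR -[lam * _](mulfVK (lt0r_neq0 n0R)) ler_wpM2r// -mulrA.
rewrite (iter_step_sum w _ (fun j => expR (m j * n%:R))
  (fun j y => if `[< K j (y%:~R / n%:R) >] then 1 else 0)).
apply: (@le_trans _ _ (\sum_(j < 2 * J) expR ((L + 3 * (e / 4)) * n%:R))).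
  apply: ler_sum => j _; apply: (le_trans (ler_wpM2l (expR_ge0 _) (HK j (ltn_ord j)))).
  rewrite -expRD -mulrDl ler_expR ler_wpM2r//; lra.
rewrite sumr_const card_ord -[leLHS]mulr_natl.
apply: (le_trans (ler_wpM2r (expR_ge0 _) nJ)).
by rewrite -expRD -mulrDl ler_expR ler_wpM2r//; lra.
Qed.

(** The expectation is restricted to the open set of velocities where [lam * y] loses less than
    [e / 2] against a nearly optimal [x]. *)
Lemma varadhan_lower w P I lam L : is_env w -> quenched_law w P ->
  LDP (velocity_law P) I -> (forall x, (0 <= I x)%E) -> (L%:E < legendre I lam)%E ->
  forall e, 0 < e -> \forall n \near \oo, expR ((L - e) * n%:R) <= mgf w lam n 0.
Proof.
move=> w01 qP LP I0 /ereal_sup_gt[_ [x _ <-] Lx] e e0.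
have [i Ix] : exists i, I x = i%:E.
  by move: (I0 x) Lx; case: (I x) => [i||]//; exists i.
pose U := [set y : R | lam * x - e / 2 < lam * y].
have oU : open U.
  rewrite [U](_ : _ = ( *%R lam) @^-1` `]lam * x - e / 2, +oo[%classic).
    by apply: open_comp; [move=> ? _; exact: mulrl_continuous|exact: rray_open].
  by apply/seteqP; split => y /=; rewrite in_itv/= andbT.
have Ux : U x by rewrite /U /= gtrBl divr_gt0.
have e2 : 0 < e / 2 by rewrite divr_gt0.
apply: filterS (@LDP_lower_near w P I U x i w01 qP LP oU Ux Ix _ e2) => n Hn.
have [->|n0] := posnP n; first by rewrite /mgf /= subrr !mulr0.
have n0R : (0 < n%:R :> R) by rewrite ltr0n.
apply: (@le_trans _ _ (expR ((lam * x - e / 2) * n%:R) * walk_prob w n U)).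
  apply: le_trans (ler_wpM2l (expR_ge0 _) Hn).
  rewrite -expRD -mulrDl ler_expR ler_wpM2r//.
  by move: Lx; rewrite Ix -EFinB lte_fin; lra.
rewrite -iter_stepZ; apply: iter_step_le => // y _.
case: asboolP => [Uy|_]; last by rewrite mulr0 expR_ge0.
rewrite mulr1 subr0 ler_expR -[leRHS](mulfVK (lt0r_neq0 n0R)) ler_wpM2r//.
by rewrite -mulrA ltW.
Qed.

Lemma varadhan w P I lam : is_env w -> quenched_law w P ->
  LDP (velocity_law P) I -> (forall x, (0 <= I x)%E) ->
  exists2 L : R, legendre I lam = L%:E &
    forall e, 0 < e -> \forall n \near \oo, tight w lam L e n 0.
Proof.
move=> w01 qP LP I0.
have [x Ix] := LDP_proper LP.
have [L EL] : exists L : R, legendre I lam = L%:E.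
  have : (-oo < legendre I lam)%E.
    apply: (@lt_le_trans _ _ ((lam * x)%:E - I x)%E).
      by move: (I0 x) Ix; case: (I x) => [i _ _||]//=; rewrite ltNyr.
    by apply: ereal_sup_ubound; exists x.
  case E : (legendre I lam) => [L||]// _; first by exists L.
  (* The value [+oo] would force growth at rate [|lam| + 1], against the trivial bound [|lam|]. *)
  have := @varadhan_lower w P I lam (`|lam| + 2) w01 qP LP I0.
  rewrite E => /(_ (ltry _) 1 ltr01) [N _ /(_ N.+1 (leqnSn N))] /=.
  have /andP[_ /[swap] /le_trans/[apply]] := mgf_bounds lam N.+1 0 w01.
  rewrite ler_expR ler_pM2r ?ltr0n//; lra.
exists L => // e e0.
have e2 : 0 < e / 2 by rewrite divr_gt0.
have H1 := @varadhan_upper w P I lam L w01 qP LP I0 _ e e0.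
have H2 := @varadhan_lower w P I lam (L - e / 2) w01 qP LP I0 _ _ e2.
rewrite EL in H1 H2.
apply: filterS2 (H1 (lexx _)) (H2 _) => [n h1 h2|].
  by rewrite /tight h1 andbT; move: h2; rewrite -addrA -opprD -splitr.
by rewrite lte_fin gtrBl.
Qed.

End varadhan.

(** * Product law *)

Section product_law.
Context {R : realType}.
Implicit Types (w : env_space R) (s : seq int) (x y : int).

Lemma measurable_site x (B : set (measurableTypeR R)) : measurable B ->
  measurable [set w : env_space R | B (w x)].
Proof. by move=> mB; apply: sub_sigma_algebra; exists x, B. Qed.

Lemma measurable_fun_site x : measurable_fun setT (fun w : env_space R => w x : R).
Proof. by move=> _ B mB; rewrite setTI; exact: measurable_site. Qed.

Lemma measurable_fun_env d (T : measurableType d) (F : T -> env_space R) :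
  (forall x (B : set (measurableTypeR R)), measurable B ->
     measurable [set t | B (F t x)]) ->
  measurable_fun setT F.
Proof.
move=> mF; apply: (@measurability _ _ T (env_space R) setT F (@coordinate_events R)) => //.
by move=> _ [_ [x [B mB ->]] <-]; rewrite setTI; exact: mF.
Qed.

Definition rectangle s (B : int -> set (measurableTypeR R)) : set (env_space R) :=
  [set w | forall x, x \in s -> B x (w x)].

Lemma measurable_rectangle s B : (forall x, measurable (B x)) ->
  measurable (rectangle s B).
Proof.
move=> mB; rewrite [rectangle s B](_ : _ =
  \bigcap_(x in [set` s]) [set w : env_space R | B x (w x)]) //.
apply: fin_bigcap_measurable => // x _; exact: measurable_site.
Qed.

Lemma product_law_unique (alpha : probability (measurableTypeR R) R)
    (mu nu : probability (env_space R) R) A :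
  product_law alpha mu -> product_law alpha nu -> measurable A -> mu A = nu A.
Proof.
move=> mulaw nulaw mA.
pose G := [set C : set (env_space R) | exists s B,
  [/\ uniq s, forall x, measurable (B x) & C = rectangle s B]].
have Gm : G `<=` measurable by move=> _ [s [B [_ mB ->]]]; exact: measurable_rectangle.
apply: (@g_sigma_algebra_measure_unique _ R (env_space R) G Gm (fun=> setT)).
- move=> _; exists [::], (fun=> setT); split => //.
  by apply/seteqP; split.
- by apply/seteqP; split => // w _; exists 0%N.
- move=> _ _ [s [B [us mB ->]]] [s' [B' [us' mB' ->]]].
  (* Rectangles are stable under intersection: the site lists are merged, and a site missing from
     one list is unconstrained by it. *)
  exists (undup (s ++ s')), (fun x => (if x \in s then B x else setT) `&`
     (if x \in s' then B' x else setT)).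
  split; first exact: undup_uniq.
    by move=> x; apply: measurableI; case: ifP.
  apply/seteqP; split => [w [h h'] x|w h].
    by rewrite mem_undup mem_cat => _; split; case: ifP => // ?; [exact: h|exact: h'].
  split => x xs; have /= := h x; rewrite mem_undup mem_cat xs ?orbT => /(_ isT) [];
  by [].
- by move=> _ [s [B [us mB ->]]]; rewrite [LHS]mulaw// [RHS]nulaw.
- by move=> _; rewrite ltey_eq fin_num_measure.
- move: A mA; apply: sub_sigma_algebra2 => _ [x [B mB ->]].
  exists [:: x], (fun=> B); split => //.
  apply/seteqP; split => [w /= Bw y|w /= h].
    by rewrite inE => /eqP ->.
  by apply: h; rewrite mem_head.
Qed.

Definition shift x w : env_space R := fun i => w (i + x).

(** The second environment is translated so that [shift x] of the splice agrees with it on all sites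
    from [y - x] on. *)
Definition splice y x (p : env_space R * env_space R) : env_space R :=
  fun i => if i < y then p.1 i else p.2 (i - x).

Lemma measurable_shift x : measurable_fun setT (shift x).
Proof. by apply: measurable_fun_env => i B mB; exact: measurable_site. Qed.

Lemma measurable_splice y x : measurable_fun setT (splice y x).
Proof.
apply: measurable_fun_env => i B mB; rewrite /splice.
case: (i < y).
  have := @measurable_fst _ _ (env_space R) (env_space R) measurableT _ (measurable_site i mB).
  by rewrite setTI.
have := @measurable_snd _ _ (env_space R) (env_space R) measurableT _ (measurable_site (i - x) mB).
by rewrite setTI.
Qed.

HB.instance Definition _ y x := isMeasurableFun.Build _ _ _ _
  (splice y x) (measurable_splice y x).

(** A rectangle pulls back to a product of two rectangles over disjoint sets of sites, so two
    independent copies splice to the same law. *)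
Lemma splice_product_law (alpha : probability (measurableTypeR R) R)
    (mu : probability (env_space R) R) y x : product_law alpha mu ->
  product_law alpha (distribution (mu \x mu)%E (splice y x)).
Proof.
move=> mulaw s B us mB.
pose s1 := [seq i <- s | i < y].
pose s2 := [seq i - x | i <- s & ~~ (i < y)].
have spliceE : splice y x @^-1` rectangle s B =
    rectangle s1 B `*` rectangle s2 (fun i => B (i + x)).
  apply/seteqP; split => [[w w'] /= h|[w w'] /= [h h'] i si].
    split => /= i.
      by rewrite mem_filter => /andP[iy si]; have := h i si; rewrite /splice iy.
    move=> /mapP[j]; rewrite mem_filter => /andP[jy sj] ->.
    by have := h j sj; rewrite /splice (negbTE jy) subrK.
  rewrite /splice; case: ifP => iy; first by apply: h; rewrite mem_filter iy.
  have := h' (i - x); rewrite /= subrK; apply.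
  by apply/mapP; exists i => //; rewrite mem_filter iy.
have mR := measurable_rectangle.
transitivity ((mu \x mu)%E (splice y x @^-1` rectangle s B)) => //.
transitivity (mu (rectangle s1 B) * mu (rectangle s2 (fun i => B (i + x)%R)))%E.
  by rewrite spliceE; apply: product_measure1E; exact: mR.
have muR s' B' : uniq s' -> (forall x, measurable (B' x)) ->
  mu (rectangle s' B') = (\prod_(x <- s') alpha (B' x))%E := mulaw s' B'.
rewrite !muR ?filter_uniq//; last first.
  by rewrite map_inj_uniq ?filter_uniq//; exact: addIr.
rewrite /s1 /s2 big_map !big_filter [RHS](bigID (fun i => i < y)) /=.
by congr (_ * _)%E; apply: eq_bigr => i _; rewrite subrK.
Qed.

(* [A] only sees the sites left of [y], and [B], translated by [x], only those
   right of it; so both can be read off a splice of two independent copies. *)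
Lemma product_law_indep (alpha : probability (measurableTypeR R) R)
    (mu : probability (env_space R) R) y x (A B : set (env_space R)) :
  product_law alpha mu -> measurable A -> measurable B ->
  (forall w w', (forall i, i < y -> w i = w' i) -> A w -> A w') ->
  (forall w w', (forall i, y - x <= i -> w i = w' i) -> B w -> B w') ->
  mu (A `&` shift x @^-1` B) = (mu A * mu B)%E.
Proof.
move=> mulaw mA mB A_loc B_loc.
have mshift : measurable (shift x @^-1` B).
  by rewrite -[X in measurable X]setTI; exact: (measurable_shift x measurableT mB).
rewrite (product_law_unique mulaw (splice_product_law y x mulaw)); last exact: measurableI.
transitivity ((mu \x mu)%E (A `*` B)); last exact: product_measure1E.
transitivity ((mu \x mu)%E (splice y x @^-1` (A `&` shift x @^-1` B))) => //.
congr ((mu \x mu)%E _); apply/seteqP; split => [[w w'] /= [Aw Bw]|].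
  split; first by apply: A_loc Aw => i iy; rewrite /splice iy.
  apply: B_loc Bw => i iy; rewrite /shift /splice ifF ?addrK//; lia.
move=> [w w'] /= [Aw Bw]; split.
  by apply: A_loc Aw => i iy; rewrite /splice iy.
apply: B_loc Bw => i iy; rewrite /shift /splice ifF ?addrK//; lia.
Qed.

End product_law.

(** * Density of atypical sites *)

Section concentration.
Context {R : realType}.
Implicit Types (w : env_space R) (x p : int) (E : set (env_space R)).

(** One implication suffices, since the hypothesis is symmetric in [w] and [w']. *)
Definition local M E := forall w w' : env_space R,
  (forall i : int, (`|i| <= M)%N -> w i = w' i) -> E w -> E w'.

Definition occ E (site : nat -> int) m w :=
  count (fun i => `[< E (shift (site i) w) >]) (iota 0 m).

Definition spaced p (W : nat) (i : nat) : int := p + (i * W)%N%:Z.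

Lemma occS E site m w :
  occ E site m.+1 w = (occ E site m w + `[< E (shift (site m) w) >])%N.
Proof. by rewrite /occ -addn1 iotaD count_cat /= addn0. Qed.

Lemma occ_geS E site m k :
  [set w | (k.+1 <= occ E site m.+1 w)%N] = [set w | (k.+1 <= occ E site m w)%N]
    `|` ([set w | (k <= occ E site m w)%N] `&` shift (site m) @^-1` E).
Proof.
apply/seteqP; split => w /=; rewrite occS; case: asboolP => Ew /=.
- by rewrite addn1 ltnS => ?; right.
- by rewrite addn0; left.
- by rewrite addn1 ltnS => -[/ltnW|[]].
- by rewrite addn0 => -[|[]].
Qed.

Lemma measurable_preshift x E : measurable E -> measurable (shift x @^-1` E).
Proof.
move=> mE; rewrite -[X in measurable X]setTI.
exact: (measurable_shift x measurableT mE).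
Qed.

Lemma measurable_occ E site m k : measurable E ->
  measurable [set w | (k <= occ E site m w)%N].
Proof.
move=> mE; elim: m k => [|m ih] [|k].
- by rewrite [X in measurable X](_ : _ = setT)//; apply/seteqP; split.
- by rewrite [X in measurable X](_ : _ = set0)//; apply/seteqP; split.
- by rewrite [X in measurable X](_ : _ = setT)//; apply/seteqP; split.
by rewrite occ_geS; apply: measurableU => //; apply: measurableI => //; exact: measurable_preshift.
Qed.

Context (alpha : probability (measurableTypeR R) R) (mu : probability (env_space R) R).
Hypothesis mulaw : product_law alpha mu.

(** Spacing [W > 2 * M] makes the windows of radius [M] disjoint, so the last site is independent of
    the earlier ones. *)
Lemma occ_indep E M W p m k : measurable E -> local M E -> (2 * M < W)%N ->
  mu ([set w | (k <= occ E (spaced p W) m w)%N]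
    `&` shift (spaced p W m) @^-1` E) =
  (mu [set w | (k <= occ E (spaced p W) m w)%N] * mu E)%E.
Proof.
move=> mE lE MW; apply: (product_law_indep (y := p + (m * W)%N%:Z - M%:Z) mulaw) => //.
- exact: measurable_occ.
- move=> w w' ww' /=; rewrite /occ; set a := count _ _; set b := count _ _.
  suff -> : a = b by [].
  apply: eq_in_count => i; rewrite mem_iota /= add0n => im.
  have iW : (i * W + W <= m * W)%N by rewrite -mulSnr leq_mul2r im orbT.
  by apply: asbool_equiv_eq; split; apply: lE => j jM; rewrite /shift ww'// /spaced; lia.
- by move=> w w' ww'; apply: lE => i iM; apply: ww'; rewrite /spaced; lia.
Qed.

(** This is the union bound over the at most [2 ^+ m] choices of occupied sites, run through
    [occ_geS]: both terms of the recursion have the same bound, hence the doubling. *)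
Lemma occ_tail E M W p m k eta : measurable E -> local M E -> (2 * M < W)%N ->
  0 <= eta -> (mu E <= eta%:E)%E ->
  (mu [set w | (k <= occ E (spaced p W) m w)%N]
    <= (2 ^+ m * eta ^+ k)%:E)%E.
Proof.
move=> mE lE MW eta0 Eeta; elim: m k => [|m ih] [|k].
- by apply: le_trans (probability_le1 _ _) _; [exact: measurable_occ|rewrite mulr1].
- rewrite [X in mu X](_ : _ = set0); last by apply/seteqP; split.
  by rewrite measure0 lee_fin mulr_ge0 ?exprn_ge0.
- apply: le_trans (probability_le1 _ _) _; first exact: measurable_occ.
  by rewrite mulr1 lee_fin exprn_ege1// ler1n.
rewrite occ_geS.
apply: le_trans (measureU2 _ _ _) _ => /=.
- exact: measurable_occ.
- by apply: measurableI; [exact: measurable_occ|exact: measurable_preshift].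
rewrite (@occ_indep E M W p m k)//.
apply: (@le_trans _ _ ((2 ^+ m * eta ^+ k.+1)%:E + (2 ^+ m * eta ^+ k)%:E * eta%:E)%E).
  by rewrite leeD// lee_pmul.
by rewrite -EFinM -EFinD lee_fin !exprS; lra.
Qed.

(** When all sites are occupied there is no choice to count, so any [eta < 1] gives decay. *)
Lemma occ_all E M W p m eta : measurable E -> local M E -> (2 * M < W)%N ->
  0 <= eta -> (mu E <= eta%:E)%E ->
  (mu [set w | (m <= occ E (spaced p W) m w)%N] <= (eta ^+ m)%:E)%E.
Proof.
move=> mE lE MW eta0 Eeta; elim: m => [|m ih].
  by apply: le_trans (probability_le1 _ _) _; [exact: measurable_occ|].
apply: (@le_trans _ _ (mu ([set w | (m <= occ E (spaced p W) m w)%N]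
    `&` shift (spaced p W m) @^-1` E))).
  apply: le_measure; rewrite ?inE; [exact: measurable_occ| |].
    by apply: measurableI; [exact: measurable_occ|exact: measurable_preshift].
  rewrite occ_geS => w [/= |//].
  have := count_size (fun i => `[< E (shift (spaced p W i) w) >]) (iota 0 m).
  by rewrite size_iota -/(occ _ (spaced p W) _ _); lia.
by rewrite (@occ_indep E M W p m m)// exprSr EFinM lee_pmul.
Qed.

Lemma count_iota (a : pred nat) b n :
  count a (iota b n) = (\sum_(j < n) a (b + j)%N)%N.
Proof.
elim: n => [|n ih]; first by rewrite big_ord0.
by rewrite -addn1 iotaD count_cat ih addn1 big_ord_recr /= addn0.
Qed.

(** Within a residue class modulo [W] the sites are [W] apart, as independence requires. *)
Lemma count_residues (a : pred nat) W m : count a (iota 0 (m * W)) =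
  (\sum_(j < W) count (fun i => a (j + i * W)%N) (iota 0 m))%N.
Proof.
elim: m => [|m ih]; first by rewrite big1.
rewrite mulSnr iotaD count_cat ih count_iota -big_split.
apply: eq_bigr => j _; rewrite -[m.+1]addn1 iotaD count_cat [iota _ 1]/= /= addn0.
by rewrite [(m * W + j)%N]addnC.
Qed.

Lemma mu_exists_le (F : nat -> set (env_space R)) W (b : R) :
  (forall j, measurable (F j)) -> (forall j, (mu (F j) <= b%:E)%E) ->
  (mu [set w | exists2 j, (j < W)%N & F j w] <= (W%:R * b)%:E)%E /\
  measurable [set w | exists2 j, (j < W)%N & F j w].
Proof.
move=> mF Fb; elim: W => [|W [ih mih]].
  rewrite [X in measurable X](_ : _ = set0); last by apply/seteqP; split => // w [].
  rewrite [X in mu X](_ : _ = set0); last by apply/seteqP; split => // w [].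
  by rewrite measure0 mul0r.
have -> : [set w | exists2 j, (j < W.+1)%N & F j w] =
    [set w | exists2 j, (j < W)%N & F j w] `|` F W.
  apply/seteqP; split => w /=.
    by move=> [j]; rewrite ltnS leq_eqVlt => /predU1P[->|jW] Fj; [right|left; exists j].
  by move=> [[j jW Fj]|Fw]; [exists j => //; exact: ltnW|exists W].
split; last exact: measurableU.
apply: le_trans (measureU2 _ _ _) _ => //.
by rewrite -natr1 mulrDl mul1r EFinD; exact: leeD ih (Fb W).
Qed.

(** A density above [kap] is inherited by some residue class modulo [W], which has about [n / W]
    sites. There [eta = expR (- (2 / kap))] gives [expR (- (2 * n / W))], while the [2 ^+ m] choices
    cost at most [expR (n / W + 1)]. *)
Lemma occ_concentration E M kap : measurable E -> local M E -> 0 < kap ->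
  (mu E <= (expR (- (2 / kap)))%:E)%E ->
  exists C c : R, [/\ 0 < C, 0 < c & forall p n,
    measurable [set w | kap * n%:R < (occ E (spaced p 1) n w)%:R] /\
    (mu [set w | (kap * n%:R < (occ E (spaced p 1) n w)%:R)%R]
       <= (C * expR (- (c * n%:R)))%:E)%E].
Proof.
move=> mE lE kap0 Ekap; pose W := (2 * M).+1.
have W0 : (0 < W%:R :> R) by rewrite ltr0n.
exists (W%:R * expR 1), W%:R^-1; split; rewrite ?mulr_gt0 ?expR_gt0 ?invr_gt0// => p n.
have kn0 : 0 <= kap * n%:R by rewrite mulr_ge0// ltW.
have mS : measurable [set w | kap * n%:R < (occ E (spaced p 1) n w)%:R].
  rewrite [X in measurable X](_ : _ =
    [set w | ((Num.truncn (kap * n%:R)).+1 <= occ E (spaced p 1) n w)%N]).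
    exact: measurable_occ.
  by apply/seteqP; split => w /=; rewrite truncn_lt_nat.
split => //.
pose m := (n %/ W).+1; pose k := (Num.truncn (kap * n%:R / W%:R)).+1.
pose F j := [set w | (k <= occ E (spaced (p + j%:Z) W) m w)%N].
have nm : (n <= m * W)%N by rewrite mulSnr {1}(divn_eq n W) leq_add2l ltnW// ltn_mod.
have mF j : measurable (F j) by exact: measurable_occ.
have Fle j : (mu (F j) <= (expR 1 * expR (- (W%:R^-1 * n%:R)))%:E)%E.
  apply: le_trans (@occ_tail E M W (p + j%:Z) m k _ mE lE _ (expR_ge0 _) Ekap) _ => //.
  rewrite lee_fin.
  apply: (@le_trans _ _ (expR 1 ^+ m * expR (- (2 / kap)) ^+ k)).
    rewrite ler_wpM2r ?exprn_ge0 ?expR_ge0// lerXn2r// ?nnegrE ?expR_ge0//.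
    by have := expR_ge1Dx (1 : R); rewrite -natr1.
  rewrite -!expRM_natr -!expRD ler_expR.
  have mle : m%:R <= W%:R^-1 * n%:R + 1 :> R.
    rewrite -natr1 lerD2r mulrC ler_pdivlMr// -natrM ler_nat; exact: leq_trunc_div.
  have : kap * n%:R / W%:R <= k%:R by apply: ltW; exact: truncnS_gt.
  rewrite -mulrA [n%:R / _]mulrC -ler_pdivlMl// => kle.
  rewrite mul1r mulrC mulrN; move: kle mle; rewrite mulrCA mulrA; lra.
have [Fsum mFsum] := mu_exists_le W mF Fle.
apply: (@le_trans _ _ (mu [set w | exists2 j, (j < W)%N & F j w])); last first.
  by rewrite -mulrA.
(* Pigeonhole: with at most [k.-1] occurrences in each class the total would not exceed
   [W * k.-1 <= kap * n]. *)
apply: le_measure; rewrite ?inE// => w /= occw; apply: contrapT => noF.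
move: occw; apply/negP; rewrite -leNgt.
have -> : kap * n%:R = W%:R * (kap * n%:R / W%:R) by rewrite [RHS]mulrC mulfVK// gt_eqF.
apply: (@le_trans _ _ (W * k.-1)%N%:R); last first.
  by rewrite natrM ler_wpM2l//= truncn_le divr_ge0.
rewrite ler_nat /occ; set a := fun i => `[< _ >].
apply: (@leq_trans (count a (iota 0 (m * W)))).
  by rewrite -(subnKC nm) iotaD count_cat leq_addr.
rewrite count_residues -[W in (W * _)%N]card_ord -sum_nat_const.
apply: leq_sum => j _; rewrite leqNgt; apply/negP => kj; apply: noF.
exists j => //; apply: leq_trans kj _; rewrite /occ /a.
by rewrite /spaced; under eq_count do rewrite muln1 PoszD addrA.
Qed.

Lemma occ_all_decay E M : measurable E -> local M E -> (mu E < 1)%E ->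
  exists C c : R, [/\ 0 < C, 0 < c & forall n,
    measurable [set w | forall j, (j < n)%N -> E (shift j%:Z w)] /\
    (mu [set w | forall j, (j < n)%N -> E (shift j%:Z w)]
       <= (C * expR (- (c * n%:R)))%:E)%E].
Proof.
move=> mE lE E1; pose W := (2 * M).+1.
have W0 : (0 < W%:R :> R) by rewrite ltr0n.
have Efin : mu E \is a fin_num by rewrite fin_num_measure.
(* The maximum keeps [eta] positive, so that its logarithm is meaningful even if [mu E] vanishes. *)
pose eta := Num.max (2^-1) (fine (mu E)).
have eta0 : 0 < eta by rewrite lt_max invr_gt0 ltr0n.
have eta1 : eta < 1.
  have fE1 : fine (mu E) < 1 by rewrite -lte_fin fineK.
  by rewrite gt_max fE1 andbT invf_lt1// ltr1n.
have lneta : 0 < - ln eta by rewrite oppr_gt0 ln_lt0// eta0.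
have Eeta : (mu E <= eta%:E)%E by rewrite -[mu E]fineK// lee_fin le_max lexx orbT.
exists (expR (- ln eta)), (- ln eta / W%:R); split; rewrite ?expR_gt0 ?divr_gt0// => n.
have mS : measurable [set w | forall j, (j < n)%N -> E (shift j%:Z w)].
  rewrite [X in measurable X](_ : _ = \bigcap_(j in [set j | (j < n)%N]) shift j%:Z @^-1` E)//.
  by apply: bigcap_measurableType => j _; exact: measurable_preshift.
split => //; pose m := (n %/ W)%N.
apply: (@le_trans _ _ (mu [set w | (m <= occ E (spaced 0 W) m w)%N])).
  apply: le_measure; rewrite ?inE//; first exact: measurable_occ.
  move=> w /= Ew; rewrite /occ (eq_in_count (a2 := predT)) ?count_predT ?size_iota//.
  move=> i; rewrite mem_iota add0n /= => im; apply/asboolP; rewrite /spaced add0r; apply: Ew.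
  apply: (@leq_trans (m * W)); last exact: leq_trunc_div.
  by rewrite ltn_pmul2r.
apply: le_trans (@occ_all E M W 0 m eta mE lE _ (ltW eta0) Eeta) _ => //.
rewrite lee_fin -{1}(lnK (x := eta))// -expRM_natr -expRD ler_expR.
have : n%:R / W%:R <= m%:R + 1 :> R.
  rewrite ler_pdivrMr// natr1 -natrM ler_nat.
  by rewrite mulSnr {1}(divn_eq n W) leq_add2l ltnW// ltn_mod.
move=> /(ler_wpM2l (ltW lneta)); rewrite mulrDr mulr1 mulrA [_ * _ / _]mulrAC; lra.
Qed.

End concentration.

(** * Random environment *)

Section environment.
Context {R : realType}.
Implicit Types (w : env_space R) (x : int) (lam : R).

Lemma negligible_bigcup_countable d (T : measurableType d) (mu : {measure set T -> \bar R})
    (U : countType) (F : U -> set T) :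
  (forall u, mu.-negligible (F u)) -> mu.-negligible (\bigcup_u F u).
Proof.
move=> F0; apply: (@negligibleS _ _ _ _ (\bigcup_k (if unpickle k is Some u then F u else set0))).
  by move=> t [u _ Fu]; exists (pickle u) => //; rewrite pickleK.
by apply: negligible_bigcup => k; case: unpickle => // ; exact: negligible_set0.
Qed.

(** Every point outside the support lies in a null interval with rational end points, and there are
    countably many of these. *)
Lemma negligible_setC_msupport (alpha : probability (measurableTypeR R) R) (K : set R) :
  msupport alpha `<=` K -> alpha.-negligible (~` K : set (measurableTypeR R)).
Proof.
move=> suppK.
pose F (pq : rat * rat) : set (measurableTypeR R) :=
  if alpha `]ratr pq.1, ratr pq.2[%classic == 0%E then `]ratr pq.1, ratr pq.2[%classic else set0.
apply: (@negligibleS _ _ _ _ (\bigcup_pq F pq)); last first.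
  apply: negligible_bigcup_countable => pq; rewrite /F; case: eqP => [F0|_].
    by apply/negligibleP => //; exact: measurable_itv.
  exact: negligible_set0.
move=> x /(contra_not (suppK x)); rewrite /msupport /=.
move=> /existsNP[U /not_implyP[oU /not_implyP[Ux /negP]]]; rewrite -leNgt => U0.
have /nbhs_ballP[r /= r0 rU] : nbhs x U by apply: open_nbhs_nbhs.
have [p] : exists q : rat, ratr q \in `]x - r, x[ by apply: rat_in_itvoo; rewrite gtrBl.
rewrite in_itv /= => /andP[xp px].
have [q] : exists q : rat, ratr q \in `]x, x + r[ by apply: rat_in_itvoo; rewrite ltrDl.
rewrite in_itv /= => /andP[xq qx].
have pqU : `]ratr p, ratr q[%classic `<=` U.
  apply: subset_trans rU; rewrite ball_itv => y /=; rewrite !in_itv /= => /andP[py yq].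
  by rewrite (lt_trans xp py) (lt_trans yq qx).
exists (p, q) => //; rewrite /F /= ifT; first by rewrite /= in_itv /= px xq.
rewrite -measure_le0; apply: le_trans U0.
have mU : measurable (U : set (measurableTypeR R)) by exact: open_measurable.
by apply: le_measure; rewrite ?inE//; exact: measurable_itv.
Qed.

Definition elliptic (c : R) : set (env_space R) := [set w | forall x, c <= w x <= 1 - c].

Lemma elliptic_is_env (c : R) w : 0 < c -> elliptic c w -> is_env w.
Proof. by move=> c0 cw x; have := cw x; lra. Qed.

Lemma negligible_setC_elliptic (alpha : probability (measurableTypeR R) R)
    (mu : probability (env_space R) R) (c : R) : product_law alpha mu ->
  msupport alpha `<=` `[c, 1 - c]%classic -> mu.-negligible (~` elliptic c).
Proof.
move=> mulaw /negligible_setC_msupport alpha0.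
apply: (@negligibleS _ _ _ _ (\bigcup_(x : int) [set w : env_space R | ~ `[c, 1 - c]%classic (w x)])).
  by move=> w /existsNP[x wx]; exists x => //=; rewrite in_itv.
apply: negligible_bigcup_countable => x.
have mB : measurable (~` `[c, 1 - c]%classic : set (measurableTypeR R)).
  by apply: measurableC; exact: measurable_itv.
apply/negligibleP; first exact: (measurable_site x mB).
have := mulaw [:: x] (fun=> ~` `[c, 1 - c]%classic) isT (fun=> mB).
rewrite big_seq1 (_ : alpha _ = 0%E); last exact/negligibleP.
move=> <-; congr (mu _); apply/seteqP; split => [w /= wx y|w /= h].
  by rewrite inE => /eqP ->.
by apply: (h x); rewrite mem_head.
Qed.

Lemma measurable_le_set d (T : measurableType d) (f g : T -> R) :
  measurable_fun setT f -> measurable_fun setT g ->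
  measurable [set t | f t <= g t].
Proof.
move=> mf mg; have := measurable_fun_ler mf mg measurableT (Y := [set true]) I.
by rewrite setTI.
Qed.

Lemma measurable_trap q K x : measurable [set w : env_space R | trap w q K x].
Proof.
rewrite [X in measurable X](_ : _ = \bigcap_(i in [set i | (0 < i < K)%N])
  ([set w : env_space R | w (x + i%:Z) * (1 + q) <= q] `&`
   [set w : env_space R | (1 - w (x - i%:Z)) * (1 + q) <= q])); last by [].
apply: bigcap_measurableType => i _; apply: measurableI; apply: measurable_le_set => //.
  by apply: measurable_funM => //; exact: measurable_fun_site.
by apply: measurable_funM => //; apply: measurable_funB => //; exact: measurable_fun_site.
Qed.

Lemma local_trap q K : local K [set w : env_space R | trap w q K 0].
Proof.
move=> w w' ww' /= wtrap i iK; have := wtrap i iK.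
by rewrite !ww'//; lia.
Qed.

Lemma trap_shift w q K x : trap (shift x w) q K 0 <-> trap w q K x.
Proof.
by split=> wtrap i iK; have := wtrap i iK; rewrite /shift !add0r ![_ + x]addrC.
Qed.

Definition window K : seq int := [seq i%:Z - K%:Z | i <- iota 0 (2 * K)%N].

Lemma window_uniq K : uniq (window K).
Proof. by rewrite map_inj_uniq ?iota_uniq// => i j; lia. Qed.

Lemma mem_window K x : (`|x| < K)%N -> x \in window K.
Proof. by move=> xK; apply/mapP; exists (absz (x + K%:Z)%R); rewrite ?mem_iota; lia. Qed.

(** Nestedness puts points [b < 1/2 < a] in the support. Values near [b] to the right of the origin
    and near [a] elsewhere form a trap, and finitely many such constraints have positive
    probability. *)
Lemma basic_trap (alpha : probability (measurableTypeR R) R)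
    (mu : probability (env_space R) R) : basic alpha mu ->
  exists2 q : R, 0 < q < 1 & forall K, (0 < mu [set w : env_space R | trap w q K 0])%E.
Proof.
move=> [_ mulaw [c c0 supp_c] /andP[rmin rmax]].
have supp01 a : msupport alpha a -> 0 < a < 1.
  by move=> /supp_c; rewrite /= in_itv /=; lra.
have [b suppb rb] : exists2 b, msupport alpha b & 1 < rho b.
  have [[_ [b suppb <-] ?]|noS] := pselect (exists2 r, (@rho R @` msupport alpha) r & 1 < r).
    by exists b.
  have : rho_max alpha <= 1.
    (* The supremum of the empty set is [0] by convention, still at most [1]. *)
    have [S0|S0] := eqVneq (@rho R @` msupport alpha) set0.
      by rewrite /rho_max S0 sup0.
    apply: ge_sup; first exact/set0P.
    by move=> r Sr; rewrite leNgt; apply/negP => r1; apply: noS; exists r.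
  by rewrite leNgt rmax.
have [a suppa ra] : exists2 a, msupport alpha a & rho a < 1.
  have [[_ [a suppa <-] ?]|noS] := pselect (exists2 r, (@rho R @` msupport alpha) r & r < 1).
    by exists a.
  have : 1 <= rho_min alpha.
    apply: lb_le_inf; first by exists (rho b), b.
    by move=> r Sr; rewrite leNgt; apply/negP => r1; apply: noS; exists r.
  by rewrite leNgt rmin.
have /andP[a0 a1] := supp01 _ suppa; have /andP[b0 b1] := supp01 _ suppb.
have b2 : b < 2^-1 by move: rb; rewrite /rho ltr_pdivlMr//; lra.
have a2 : 2^-1 < a by move: ra; rewrite /rho ltr_pdivrMr//; lra.
(* A midpoint, so that [b < t], [1 - t < a] and [t < 1/2]; the trap parameter [q] is the odds
   [t / (1 - t)]. *)
pose t := (Num.max b (1 - a) + 2^-1) / 2.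
have mb : b <= Num.max b (1 - a) by rewrite le_max lexx.
have ma : 1 - a <= Num.max b (1 - a) by rewrite le_max lexx orbT.
have mt : Num.max b (1 - a) < 2^-1 by rewrite gt_max b2 /=; lra.
have bt : b < t by rewrite /t; lra.
have at' : 1 - t < a by rewrite /t; lra.
have t2 : t < 2^-1 by rewrite /t; lra.
have t0 : 0 < t by lra.
have t1 : 0 < 1 - t by lra.
have tq y : y < t -> y * (1 + t / (1 - t)) <= t / (1 - t).
  move=> yt; have -> : 1 + t / (1 - t) = (1 - t)^-1 by field; rewrite gt_eqF.
  by rewrite ler_pM2r ?invr_gt0// ltW.
exists (t / (1 - t)).
  by rewrite divr_gt0//= ltr_pdivrMr// mul1r; lra.
move=> K.
pose U (x : int) : set (measurableTypeR R) :=
  if 0 < x then `]-oo, t[%classic else `]1 - t, +oo[%classic.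
have mU x : measurable (U x) by rewrite /U; case: ifP => _; exact: measurable_itv.
have U0 x : (0 < alpha (U x))%E.
  rewrite /U; case: ifP => _.
    by apply: suppb; [exact: lray_open|rewrite /= in_itv].
  by apply: suppa; [exact: rray_open|rewrite /= in_itv /= andbT].
apply: (@lt_le_trans _ _ (mu (rectangle (window K) U))).
  rewrite [mu _]mulaw//; last exact: window_uniq.
  by elim/big_ind: _ => // u v u0 v0; exact: mule_gt0.
apply: le_measure; rewrite ?inE; [exact: measurable_rectangle|exact: measurable_trap|].
move=> w sw i /andP[i0 iK]; split.
  have /sw : 0 + i%:Z \in window K by rewrite add0r mem_window.
  by rewrite /U ifT ?add0r//= in_itv /=; exact: tq.
have /sw : 0 - i%:Z \in window K by rewrite sub0r mem_window ?abszN.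
rewrite /U ifF /=; last by rewrite sub0r ltrNr oppr0.
by rewrite in_itv /= andbT => wi; apply: tq; lra.
Qed.

Lemma measurable_iter_step (f : int -> R) k x :
  measurable_fun setT (fun w : env_space R => iter k (step w) f x).
Proof.
elim: k x => [|k ih] x /=; first exact: measurable_cst.
rewrite /step; apply: measurable_funD; apply: measurable_funM => //.
  exact: measurable_fun_site.
by apply: measurable_funB => //; exact: measurable_fun_site.
Qed.

Lemma measurable_mgf lam n x : measurable_fun setT (fun w : env_space R => mgf w lam n x).
Proof. exact: measurable_iter_step. Qed.

Lemma iter_step_local w w' (f : int -> R) k x :
  (forall y, (`|y - x| < k)%N -> w y = w' y) ->
  iter k (step w) f x = iter k (step w') f x.
Proof.
elim: k x => //= k ih x ww'; rewrite /step ww' ?subrr// !ih// => y yk; apply: ww'; lia.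
Qed.

Lemma mgf_shift w lam n x : mgf (shift x w) lam n 0 = mgf w lam n x.
Proof.
have H f y : iter n (step (shift x w)) (fun z => f (z + x)) y = iter n (step w) f (y + x).
  by elim: n y => //= n ih y; rewrite /step !ih /shift addrAC [y - 1 + x]addrAC.
have := H (fun z => expR (lam * (z - x)%:~R)) 0; rewrite add0r /mgf => <-.
by congr (iter n _ _ _); apply/funext => z; rewrite addrK subr0.
Qed.

(** The environment in which the mirrored walk [- Z] moves. *)
Definition reflect_env w : env_space R := fun i => 1 - w (- i).

Lemma mgf_reflect w lam n x : mgf (reflect_env w) (- lam) n x = mgf w lam n (- x).
Proof.
rewrite /mgf.
have H f y : iter n (step (reflect_env w)) (fun z => f (- z)) y = iter n (step w) f (- y).
  elim: n y => //= n ih y.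
  rewrite /step !ih /reflect_env (_ : - (y + 1) = - y - 1); last lia.
  by rewrite (_ : - (y - 1) = - y + 1); [rewrite subKr addrC|lia].
rewrite -H; congr (iter n _ _ _); apply/funext => z; congr (expR _).
by rewrite mulNr -mulrN -rmorphN; congr (_ * _%:~R); lia.
Qed.

(** The origin is atypical. The upper limit [M] on the times makes this a local event. *)
Definition untight lam L e N M : set (env_space R) :=
  [set w | exists2 k, (N <= k < M)%N & ~~ tight w lam L e k 0].

Lemma measurable_untight lam L e N M : measurable (untight lam L e N M).
Proof.
rewrite [untight _ _ _ _ _](_ : _ = \bigcup_(k in [set k | (N <= k < M)%N])
    ~` ([set w : env_space R | expR ((L - e) * k%:R) <= mgf w lam k 0] `&`
        [set w : env_space R | mgf w lam k 0 <= expR ((L + e) * k%:R)])).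
  apply: bigcup_measurable => k _; apply: measurableC.
  by apply: measurableI; apply: measurable_le_set => //; exact: measurable_mgf.
apply/seteqP; split => w [k NkM].
  by rewrite /tight => /andP h; exists k.
by move=> h; exists k => //; apply/andP.
Qed.

Lemma local_untight lam L e N M : local M (untight lam L e N M).
Proof.
move=> w w' ww' [k /andP[Nk kM] kt]; exists k; first by rewrite Nk.
rewrite /tight /mgf -(iter_step_local (w := w))// => y yk; apply: ww'; lia.
Qed.

Lemma untight_shift w lam L e N M x k : ~ untight lam L e N M (shift x w) ->
  (N <= k < M)%N -> tight w lam L e k x.
Proof.
move=> Ngood NkM; rewrite /tight -mgf_shift; apply: contrapT => /negP kt.
by apply: Ngood; exists k.
Qed.

End environment.

(** * Estimates in a good environment *)

Section good_environment.
Context {R : realType}.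
Implicit Types (w : env_space R) (lam L e c : R) (bad : pred nat).

Lemma exists_nat_le_exp (a e : R) : 0 < e ->
  exists2 n0 : nat, (0 < n0)%N & forall n, (n0 <= n)%N -> a <= expR (e * n%:R).
Proof.
move=> /(near_le_exp a)[N _ HN]; exists N.+1 => // n Nn.
by apply: HN => /=; exact: ltnW.
Qed.

(** With [r = L + e], the resolvent terms at a good site are at most [1] from time [N] on and at
    most [expR (lam * N)] before. The three losses [e] come from [r], from [lam - th] and from the
    bad sites. *)
Lemma mgf_upper_of_good lam L e : 0 < lam -> 0 <= L -> 0 < e ->
  exists2 kap : R, 0 < kap & forall N, exists M0 (D : R), forall M w bad n,
    (M0 <= M)%N -> is_env w ->
    (forall i, ~~ bad i -> forall k, (N <= k < M)%N ->
       mgf w lam k i%:Z <= expR ((L + e) * k%:R)) ->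
    (count bad (iota 0 n))%:R <= kap * n%:R ->
    mgf w lam n 0 <= D * expR ((L + 3 * e) * n%:R).
Proof.
move=> lam0 L0 e0; exists (e / lam); first by rewrite divr_gt0.
move=> N.
pose r := L + e; have r0 : 0 < r by rewrite /r; lra.
pose th := Num.max 0 (lam - e).
have th0 : 0 <= th by rewrite /th le_max lexx.
have thlam : th < lam by rewrite /th gt_max lam0 /=; lra.
have the : lam - e <= th by rewrite /th le_max lexx orbT.
pose d := lam - th; have d0 : 0 < d by rewrite subr_gt0.
(* This makes the no-arrival term [expR (- r) ^+ (K * l)] at most [expR (- (lam * l))]. *)
pose K := (Num.truncn (lam / r)).+1.
have Kr : lam <= K%:R * r.
  by rewrite -ler_pdivrMr//; apply: ltW; exact: truncnS_gt.
pose a := expR (lam * N%:R).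
have a1 : 1 <= a by rewrite -[leLHS]expR0 ler_expR mulr_ge0// ltW.
have d20 : 0 < d / 2 by rewrite divr_gt0.
have [l l0 Hl] := exists_nat_le_exp (1 + 2 * K%:R * a / d) d20.
(* Half of the exponent beats the constant, the other half the factor linear in [l]. *)
have {}Hl : K%:R * l%:R * a + 1 <= expR (d * l%:R).
  have -> : expR (d * l%:R) = expR (d / 2 * l%:R) * expR (d / 2 * l%:R).
    by rewrite -expRD; congr expR; field.
  have B0 : 0 <= 2 * K%:R * a / d by rewrite divr_ge0 ?mulr_ge0 ?expR_ge0// ltW.
  have x0 : 0 <= d / 2 * l%:R by rewrite mulr_ge0// ltW.
  apply: (@le_trans _ _ ((1 + 2 * K%:R * a / d) * (1 + d / 2 * l%:R))).
    rewrite mulrDl mul1r mulrDr mulr1.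
    have -> : 2 * K%:R * a / d * (d / 2 * l%:R) = K%:R * l%:R * a.
      by field; rewrite gt_eqF.
    lra.
  apply: ler_pM; rewrite ?addr_ge0//; [exact: Hl|exact: expR_ge1Dx].
exists (K * l)%N, (2 * expR (lam * l%:R)) => M w bad n KlM w01 good badn.
have := @mgf_greedy_le _ w lam r th ((K * l)%:R * a) (K * l) l bad n w01 (ltW r0).
rewrite th0 (ltW thlam) => /(_ isT l0).
have Sth : expR (- (lam * l%:R)) * ((K * l)%:R * a) + expR (- r) ^+ (K * l)
    <= expR (- (th * l%:R)).
  apply: (@le_trans _ _ (expR (- (lam * l%:R)) * (K%:R * l%:R * a + 1))).
    rewrite mulrDr mulr1 natrM lerD2l -expRM_natr ler_expR mulNr lerN2 natrM mulrA.
    by rewrite ler_wpM2r// mulrC.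
  have := ler_wpM2l (expR_ge0 (- (lam * l%:R))) Hl => /le_trans; apply.
  by rewrite -expRD ler_expR /d; lra.
move=> /(_ Sth).
have HH i : ~~ bad i ->
    \sum_(k < K * l) expR (- r) ^+ k * mgf w lam k i%:Z <= (K * l)%:R * a.
  move=> goodi; rewrite -[X in X%:R * _]card_ord mulr_natl -sumr_const.
  apply: ler_sum => k _; rewrite -expRM_natr.
  have [Nk|kN] := leqP N k.
    apply: le_trans a1.
    have := good i goodi k; rewrite Nk (leq_trans (ltn_ord k) KlM) => /(_ isT) gk.
    have := ler_wpM2l (expR_ge0 (- r * k%:R)) gk => /le_trans; apply.
    by rewrite -expRD -mulrDl addNr mul0r expR0.
  have /andP[_ mk] := mgf_bounds lam k i%:Z w01.
  have := ler_wpM2l (expR_ge0 (- r * k%:R)) mk => /le_trans; apply.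
  rewrite -expRD ler_expR gtr0_norm//.
  have : lam * k%:R <= lam * N%:R by rewrite ler_wpM2l ?ler_nat ?(ltW lam0) ?(ltnW kN).
  have : 0 <= r * k%:R by rewrite mulr_ge0// ltW.
  lra.
move=> /(_ HH) /le_trans; apply.
rewrite -mulrA -expRD ler_pM2l// ler_expR /r.
have : (lam - th) * n%:R <= e * n%:R by rewrite ler_wpM2r//; lra.
have : th * l%:R <= lam * l%:R by rewrite ler_wpM2r// ltW.
have : th * (count bad (iota 0 n))%:R <= e * n%:R.
  apply: (@le_trans _ _ (lam * (e / lam * n%:R))); last first.
    by rewrite mulrA [lam * _]mulrC mulfVK// gt_eqF.
  by apply: ler_pM => //; exact: ltW.
lra.
Qed.

(** Lowering the rate from [L - e] to [s = L - 2 * e] gains a factor [2] for large [N], which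
    provides the [+ 1] of the greedy bound; the third [e] pays for the bad sites. *)
Lemma mgf_lower_of_good lam L e c : 0 < lam -> 0 < e -> 2 * e <= L -> 0 < c ->
  exists kap : R, 0 < kap /\ exists N1, forall N, (N1 <= N)%N ->
  exists2 D : R, 0 < D & forall w bad n, elliptic c w ->
    (forall i, ~~ bad i -> expR ((L - e) * N%:R) <= mgf w lam N i%:Z) ->
    (count bad (iota 0 n))%:R <= kap * n%:R ->
    D * expR ((L - 3 * e) * n%:R) <= mgf w lam n 0.
Proof.
move=> lam0 e0 eL c0.
pose s := L - 2 * e; have s0 : 0 <= s by rewrite subr_ge0.
pose nu := `|s - ln c| + 1.
have nu0 : 0 < nu by rewrite ltr_wpDl.
exists (e / nu); split; first by rewrite divr_gt0.
have [N1 N10 HN1] := exists_nat_le_exp 2 e0.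
exists N1 => N N1N; exists (expR (- (s * N%:R)) * c ^+ N).
  by rewrite mulr_gt0 ?expR_gt0 ?exprn_gt0.
move=> w bad n ell good badn.
have w01 := elliptic_is_env c0 ell.
have cw x : c <= w x by have /andP[] := ell x.
have N0 : (0 < N)%N by exact: leq_trans N1N.
have good' i : ~~ bad i -> expR (s * N%:R) + 1 <= mgf w lam N i%:Z.
  move=> /good; apply: le_trans.
  have -> : (L - e) * N%:R = s * N%:R + e * N%:R by rewrite /s; ring.
  have E1 : 1 <= expR (s * N%:R) by rewrite -[leLHS]expR0 ler_expR mulr_ge0.
  rewrite expRD; have := ler_wpM2l (expR_ge0 (s * N%:R)) (HN1 _ N1N).
  lra.
apply: le_trans (@mgf_greedy_ge _ w lam c s N bad n 0 w01 c0 cw lam0 s0 N0 good').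
set b := count _ _ in badn *.
have kapE : c * expR (- s) = expR (- (s - ln c)).
  by rewrite (_ : - (s - ln c) = ln c + - s); [rewrite expRD lnK|ring].
rewrite kapE -expRM_natr [leLHS]mulrAC ler_wpM2r ?exprn_ge0 ?(ltW c0)//.
rewrite -!expRD ler_expR.
have : (s - ln c) * b%:R <= e * n%:R.
  apply: (@le_trans _ _ (nu * (e / nu * n%:R))).
    apply: (@le_trans _ _ (nu * b%:R)); last by rewrite ler_wpM2l// ltW.
    by rewrite ler_wpM2r//; apply: le_trans (ler_norm _) _; rewrite lerDl.
  by rewrite mulrA [nu * _]mulrC mulfVK// gt_eqF.
rewrite /s; lra.
Qed.

Lemma mgf_of_trap lam e c q : 0 < e -> 0 < c -> 0 < q < 1 ->
  exists K (kap : R), [/\ (0 < K)%N, 0 < kap < 1 & exists2 D : R, 0 < D &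
    forall w n j, elliptic c w -> trap w q K j%:Z -> j%:R <= kap * n%:R ->
    D * expR (- (e * n%:R)) <= mgf w lam n 0].
Proof.
move=> e0 c0 q01; have /andP[q0 q1] := q01.
pose e' := 1 - expR (- (e / 2)).
have e'01 : 0 < e' < 1.
  by rewrite /e' subr_gt0 gtrBl expR_gt0 andbT -[ltRHS]expR0 ltr_expR oppr_lt0 divr_gt0.
have /andP[e'0 e'1] := e'01.
have lnq : 0 < - ln q by rewrite oppr_gt0 ln_lt0.
have [k _ Hk] := exists_nat_le_exp e'^-1 lnq.
(* [nu] bounds the cost per site of walking to the trap; its summand [e] ensures [kap < 1] and
   [j <= n]. *)
pose nu := `| `|lam| - ln c| + 1 + e.
have nu0 : 0 < nu by rewrite addr_gt0// ltr_wpDl.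
exists k.+1, (e / 2 / nu); split => //.
  rewrite !divr_gt0//= ltr_pdivrMr// mul1r /nu.
  have : 0 <= `| `|lam| - ln c| by []. lra.
exists (expR (- (`|lam| * k.+1%:R)) * (1 - q)).
  by rewrite mulr_gt0 ?expR_gt0 ?subr_gt0.
move=> w n j ell wtrap jn.
have w01 := elliptic_is_env c0 ell.
have cw x : c <= w x by have /andP[] := ell x.
have jn' : j%:R * nu <= e / 2 * n%:R.
  by rewrite -ler_pdivlMr// mulrAC.
have ejn : (j <= n)%N.
  rewrite -(ler_nat R) -(ler_pM2r e0).
  apply: (@le_trans _ _ (j%:R * nu)); first by rewrite ler_wpM2l// lerDr addr_ge0.
  by apply: le_trans jn' _; rewrite mulrC ler_wpM2l//; lra.
have qk : q ^+ k.+1.-1 <= e'.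
  rewrite /= -[leLHS]invrK -[leRHS]invrK lef_pV2 ?posrE ?invr_gt0 ?exprn_gt0//.
  apply: le_trans (Hk _ (leqnn k)) _.
  by rewrite mulNr expRN mulrC expRM_natl lnK.
apply: le_trans (@mgf_trap _ w lam c q e' k.+1 j n w01 c0 cw q01 e'01 isT qk wtrap ejn).
rewrite !mulrA [leLHS]mulrAC ler_wpM2r ?subr_ge0 ?(ltW q1)//.
have -> : 1 - e' = expR (- (e / 2)) by rewrite /e' subKr.
have -> : c ^+ j = expR (ln c * j%:R) by rewrite expRM_natr lnK.
rewrite -expRM_natr -!expRD ler_expR natrD.
have : (`|lam| - ln c) * j%:R <= e / 2 * n%:R.
  apply: le_trans jn'; rewrite mulrC ler_wpM2l//.
  by apply: le_trans (ler_norm _) _; rewrite /nu -addrA lerDl addr_ge0// ltW.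
have : e / 2 * (n - j)%:R <= e / 2 * n%:R.
  by rewrite ler_wpM2l ?divr_ge0 ?(ltW e0)// ler_nat leq_subr.
lra.
Qed.

(** The multiplicative constants are absorbed by a fourth [e] for large [n]. The order of
    quantifiers matters: [kap] fixes how rare bad sites must be, then [N] is taken large enough for
    this, and [M] depends on [N]. *)
Lemma tight_of_good lam L e c : 0 < lam -> 0 <= L -> 0 < e -> 0 < c ->
  exists kap : R, 0 < kap /\ exists N1, forall N, (N1 <= N)%N ->
  exists M n0, forall w bad n, (n0 <= n)%N -> elliptic c w ->
    (forall i, ~~ bad i -> forall k, (N <= k < M)%N -> tight w lam L e k i%:Z) ->
    (count bad (iota 0 n))%:R <= kap * n%:R ->
    expR (- (e * n%:R)) <= mgf w lam n 0 ->
    tight w lam L (4 * e) n 0.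
Proof.
move=> lam0 L0 e0 c0.
have [kap1 kap10 upper] := mgf_upper_of_good lam0 L0 e0.
have [kap2 [kap20 [N1 lower]]] : exists kap2 : R, 0 < kap2 /\ exists N1,
    forall N, (N1 <= N)%N -> exists2 D : R, 0 < D & forall w bad n, elliptic c w ->
    (forall i, ~~ bad i -> expR ((L - e) * N%:R) <= mgf w lam N i%:Z) ->
    (count bad (iota 0 n))%:R <= kap2 * n%:R ->
    expR (- (e * n%:R)) <= mgf w lam n 0 ->
    D * expR ((L - 3 * e) * n%:R) <= mgf w lam n 0.
  (* For [L < 2 * e] the lower bound is the trapping estimate. *)
  have [eL|Le] := leP (2 * e) L.
    have [kap2 [kap20 [N1 H]]] := mgf_lower_of_good lam0 e0 eL c0.
    exists kap2; split => //; exists N1 => N N1N; have [D D0 HD] := H N N1N.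
    by exists D => // w bad n ell good badn _; exact: HD badn.
  exists 1; split => //; exists 0%N => N _; exists 1 => // w bad n _ _ _ /(le_trans _); apply.
  rewrite mul1r ler_expR -[leRHS]mulNr ler_wpM2r//; lra.
exists (Num.min kap1 kap2); split; first by rewrite lt_min kap10.
exists N1 => N N1N.
have [M0 [D Hup]] := upper N.
have [D' D'0 Hlow] := lower N N1N.
have [n1 n10 Hn1] := exists_nat_le_exp D e0.
have [n2 n20 Hn2] := exists_nat_le_exp D'^-1 e0.
exists (maxn M0 N.+1), (maxn n1 n2) => w bad n; rewrite geq_max => /andP[n1n n2n].
move=> ell good badn trapn.
have w01 := elliptic_is_env c0 ell.
rewrite /tight; apply/andP; split.
  apply: le_trans (Hlow w bad n ell _ _ trapn).
  - have H : 1 <= D' * expR (e * n%:R) by rewrite -ler_pdivrMl// mulr1; exact: Hn2.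
    have := ler_wpM2r (expR_ge0 ((L - 4 * e) * n%:R)) H; rewrite mul1r => /le_trans; apply.
    by rewrite -mulrA -expRD; apply: ler_wpM2l; [exact: ltW|rewrite ler_expR; lra].
  - move=> i /good /(_ N); rewrite leqnn leq_max ltnSn orbT => /(_ isT).
    by rewrite /tight => /andP[].
  - by apply: le_trans badn _; rewrite ler_wpM2r// ge_min lexx orbT.
apply: le_trans (Hup (maxn M0 N.+1) w bad n (leq_maxl _ _) w01 _ _) _.
- by move=> i /good H k /H; rewrite /tight => /andP[].
- by apply: le_trans badn _; rewrite ler_wpM2r// ge_min lexx.
have := ler_wpM2r (expR_ge0 ((L + 3 * e) * n%:R)) (Hn1 _ n1n) => /le_trans; apply.
by rewrite -expRD ler_expR; lra.
Qed.

End good_environment.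

(** * Exponential decay *)

Section decay.
Context {R : realType} (alpha : probability (measurableTypeR R) R)
  (mu : probability (env_space R) R).
Implicit Types (w : env_space R) (lam L e c : R).

Lemma negligible_avoid d (T : measurableType d) (m : probability T R) (A B : set T) :
  m.-negligible A -> measurable B -> (m B < 1)%E -> exists t, ~ A t /\ ~ B t.
Proof.
move=> [N [mN N0 AN]] mB B1; apply: contrapT => noT.
have : (m setT <= m N + m B)%E.
  apply: le_trans (measureU2 _ mN mB); apply: le_measure; rewrite ?inE//.
    exact: measurableU.
  move=> t _; apply: contrapT => tAB; apply: noT; exists t.
  by split => [/AN|] ?; apply: tAB; [left|right].
by rewrite [m N]N0 add0e probability_setT leNgt B1.
Qed.

(** Continuity from above along the events of failing at some time [>= N], whose intersection is
    null; this makes the bound uniform in [M]. *)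
Lemma untight_small lam L :
  mu.-negligible [set w | ~ forall e, 0 < e -> \forall n \near \oo, tight w lam L e n 0] ->
  forall e eta, 0 < e -> 0 < eta -> exists N0, forall N M, (N0 <= N)%N ->
  (mu (untight lam L e N M) <= eta%:E)%E.
Proof.
move=> tight_ae e eta e0 eta0.
pose A N := \bigcup_M untight (R := R) lam L e N M.
have mA N : measurable (A N) by apply: bigcupT_measurable => M; exact: measurable_untight.
have A0 : mu (\bigcap_N A N) = 0%E.
  apply/negligibleP; first exact: bigcapT_measurable.
  apply: negligibleS tight_ae => w Aw /= /(_ e e0)[N _ HN].
  by have [M _ [k /andP[Nk _]]] := Aw N I; rewrite HN.
have A_cvg : mu \o A @ \oo --> 0%E.
  rewrite -A0; apply: nonincreasing_cvg_mu => //.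
  - by rewrite ltey_eq fin_num_measure.
  - exact: bigcapT_measurable.
  - move=> n m nm; apply/subsetPset => w [M _ [k /andP[mk kM] kt]].
    by exists M => //; exists k => //; rewrite (leq_trans nm).
have [] := A_cvg [set x | (x < eta%:E)%E].
  by apply: open_nbhs_nbhs; split; [exact: open_ereal_lt_ereal|rewrite /= lte_fin].
move=> N0 _ HN0; exists N0 => N M NN0.
apply: le_trans (ltW (HN0 N NN0)).
apply: le_measure; rewrite ?inE//; first exact: measurable_untight.
by move=> w ?; exists M.
Qed.

Hypothesis mulaw : product_law alpha mu.

(** The exceptional event is the absence of traps centred among the first sites, about [kap * n] of
    them. *)
Lemma low_mgf_decay lam e c q : 0 < e -> 0 < c -> 0 < q < 1 ->
  (forall K, (0 < mu [set w : env_space R | trap w q K 0])%E) ->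
  exists (C c' : R) (n0 : nat), [/\ 0 < C, 0 < c' & forall n, exists T : set (env_space R),
    [/\ measurable T, (mu T <= (C * expR (- (c' * n%:R)))%:E)%E &
     forall w, ~ T w -> elliptic c w -> (n0 <= n)%N ->
       expR (- (e * n%:R)) <= mgf w lam n 0]].
Proof.
move=> e0 c0 q01 trap0.
have e2 : 0 < e / 2 by rewrite divr_gt0.
have [K [kap [K0 /andP[kap0 kap1] [D D0 HD]]]] := @mgf_of_trap R lam (e / 2) c q e2 c0 q01.
pose E := ~` [set w : env_space R | trap w q K 0].
have mE : measurable E by apply: measurableC; exact: measurable_trap.
have lE : local K E.
  by move=> w w' ww' Ew w't; apply: Ew; apply: local_trap w't => i iK; rewrite ww'.
have E1 : (mu E < 1)%E.
  have mt := measurable_trap q K (0 : int) (R := R).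
  have -> : mu E = (1 - mu [set w : env_space R | trap w q K 0])%E.
    exact: probability_setC mt.
  have := trap0 K; rewrite -[mu [set _ | _]]fineK ?fin_num_measure// !lte_fin => t0.
  by rewrite gtrBl.
have [C [c' [C0 c'0 HC]]] := occ_all_decay mulaw mE lE E1.
have [n0 n00 Hn0] := exists_nat_le_exp D^-1 e2.
exists C, (c' * kap), n0; split; rewrite ?mulr_gt0// => n.
pose n' := (Num.truncn (kap * n%:R)).+1.
have [mT Tle] := HC n'.
exists [set w | forall j, (j < n')%N -> E (shift j%:Z w)]; split => //.
  apply: le_trans Tle _; rewrite lee_fin ler_pM2l// ler_expR lerN2 -mulrA ler_pM2l//.
  by apply: ltW; exact: truncnS_gt.
move=> w noT ell n0n.
have [j jn' wt] : exists2 j, (j < n')%N & trap w q K j%:Z.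
  apply: contrapT => noj; apply: noT => j jn' /trap_shift wt.
  by apply: noj; exists j.
have jn : j%:R <= kap * n%:R.
  by rewrite -truncn_ge_nat ?mulr_ge0 ?(ltW kap0).
apply: le_trans (HD w n j ell wt jn).
have -> : expR (- (e * n%:R)) = expR (- (e / 2 * n%:R)) * expR (- (e / 2 * n%:R)).
  by rewrite -expRD; congr expR; field.
rewrite ler_wpM2r ?expR_ge0// expRN -[leRHS]invrK lef_pV2 ?posrE ?invr_gt0 ?expR_gt0//.
exact: Hn0.
Qed.

(** If [L < 0], then with [e = - L / 3] some environment satisfies both the typical upper bound at
    rate [L + e = - 2 * e] and the trapping lower bound at rate [- e]. *)
Lemma log_mgf_limit_ge0 lam L c q : 0 < c -> 0 < q < 1 ->
  (forall K, (0 < mu [set w : env_space R | trap w q K 0])%E) ->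
  mu.-negligible (~` elliptic c) ->
  mu.-negligible [set w | ~ forall e, 0 < e -> \forall n \near \oo, tight w lam L e n 0] ->
  0 <= L.
Proof.
move=> c0 q01 trap0 ell_ae tight_ae; rewrite leNgt; apply/negP => L0.
have e0 : 0 < - L / 3 by rewrite divr_gt0// oppr_gt0.
set e := - L / 3 in e0.
have [C [c' [n0 [C0 c'0 low]]]] := low_mgf_decay lam e0 c0 q01 trap0.
have q0 : 0 < 4^-1 :> R by rewrite invr_gt0.
have [N0 small] := untight_small tight_ae e0 q0.
have [n1 n10 Hn1] := exists_nat_le_exp (4 * C) c'0.
pose n := maxn n1 (maxn n0 N0).
have [T [mT Tle HT]] := low n.
have mu1 := measurable_untight lam L e n n.+1 (R := R).
have [w [/contrapT ell]] : exists w, ~ (~` elliptic c) w /\ ~ (T `|` untight lam L e n n.+1) w.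
  apply: (negligible_avoid ell_ae); first exact: measurableU.
  apply: le_lt_trans (measureU2 _ mT mu1) _.
  apply: (@le_lt_trans _ _ ((4^-1)%:E + (4^-1)%:E)%E).
    apply: leeD; last by apply: small; rewrite /n !leq_max leqnn !orbT.
    apply: le_trans Tle _; rewrite lee_fin expRN ler_pdivrMr ?expR_gt0//.
    by rewrite mulrC ler_pdivlMr// mulrC; apply: Hn1; rewrite leq_max leqnn.
  by rewrite -EFinD lte_fin; lra.
move=> /not_orP[nT nU].
have := HT w nT ell; rewrite /n !leq_max leqnn !orbT => /(_ isT); rewrite -/n.
have : tight w lam L e n 0.
  by apply: contrapT => /negP nt; apply: nU; exists n => //; rewrite leqnn ltnSn.
move=> /andP[_ /[swap] /le_trans/[apply]]; rewrite ler_expR -mulNr ler_pM2r.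
  by rewrite /e; lra.
by rewrite ltr0n !leq_max n10.
Qed.

(** The sites [0, -1, ..., 1 - n] explored by the reflected walk form an ordinary run when read from
    the left. *)
Lemma occ_oppz E n w : occ E (fun i => - i%:Z) n w = occ E (spaced (1 - n%:Z) 1) n w.
Proof.
rewrite /occ !count_iota (reindex_inj rev_ord_inj) /=; apply: eq_bigr => j _.
by congr (nat_of_bool `[< E (shift _ w) >]); have := ltn_ord j; rewrite /spaced; lia.
Qed.

Lemma tight_reflect w lam L e k x :
  tight (reflect_env w) (- lam) L e k x = tight w lam L e k (- x).
Proof. by rewrite /tight mgf_reflect. Qed.

Lemma elliptic_reflect c w : elliptic c w -> elliptic c (reflect_env w).
Proof. by move=> ell x; have := ell (- x); rewrite /reflect_env; lra. Qed.

Lemma tight_decay lam L e c q : lam != 0 -> 0 < e -> 0 < c -> 0 < q < 1 ->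
  (forall K, (0 < mu [set w : env_space R | trap w q K 0])%E) ->
  mu.-negligible (~` elliptic c) ->
  mu.-negligible [set w | ~ forall e, 0 < e -> \forall n \near \oo, tight w lam L e n 0] ->
  exists C c' : R, [/\ 0 < C, 0 < c' & forall n, exists T : set (env_space R),
    [/\ measurable T, (mu T <= (C * expR (- (c' * n%:R)))%:E)%E &
     forall w, ~ T w -> elliptic c w -> tight w lam L (4 * e) n 0]].
Proof.
move=> lamN0 e0 c0 q01 trap0 ell_ae tight_ae.
have L0 := log_mgf_limit_ge0 c0 q01 trap0 ell_ae tight_ae.
have nlam0 : 0 < `|lam| by rewrite normr_gt0.
have [kap [kap0 [N1 HN1]]] := tight_of_good nlam0 L0 e0 c0.
have [N0 small] := untight_small tight_ae e0 (expR_gt0 (- (2 / kap))).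
pose N := maxn N1 N0.
have [M [n1 HM]] := HN1 N (leq_maxl _ _).
have mE := measurable_untight lam L e N M (R := R).
have lE := @local_untight R lam L e N M.
have [C1 [c1 [C10 c10 Hocc]]] := occ_concentration mulaw mE lE kap0 (small N M (leq_maxr _ _)).
have [C2 [c2 [n2 [C20 c20 Hlow]]]] := low_mgf_decay lam e0 c0 q01 trap0.
pose n0 := maxn n1 n2; pose c' := Num.min c1 c2.
have c'0 : 0 < c' by rewrite lt_min c10.
(* The last summand makes the bound at least one for [n < n0], where the exceptional set is
   everything. *)
exists (C1 + C2 + expR (c' * n0%:R)), c'; split => //.
  by rewrite !addr_gt0 ?expR_gt0.
move=> n; have [nn0|n0n] := ltnP n n0.
  exists setT; split => //; last by move=> w [].
  rewrite [X in (X <= _)%E]probability_setT lee_fin.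
  apply: (@le_trans _ _ (expR (c' * n0%:R) * expR (- (c' * n%:R)))).
    rewrite -expRD -[leLHS]expR0 ler_expR subr_ge0 ler_wpM2l ?(ltW c'0)//.
    by rewrite ler_nat ltnW.
  by rewrite ler_wpM2r ?expR_ge0// lerDr addr_ge0// ltW.
have [mS Sle] := Hocc (if 0 < lam then 0 else 1 - n%:Z) n.
have [T [mT Tle HT]] := Hlow n.
set S := [set w | _] in mS Sle.
exists (S `|` T); split.
- exact: measurableU.
- apply: le_trans (measureU2 _ mS mT) _.
  apply: (@le_trans _ _ ((C1 * expR (- (c1 * n%:R)))%:E + (C2 * expR (- (c2 * n%:R)))%:E)%E).
    exact: leeD.
  rewrite -EFinD lee_fin.
  have ec i : c' <= i -> expR (- (i * n%:R)) <= expR (- (c' * n%:R)).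
    by move=> ci; rewrite ler_expR lerN2 ler_wpM2r.
  have c'1 : c' <= c1 by rewrite ge_min lexx.
  have c'2 : c' <= c2 by rewrite ge_min lexx orbT.
  have h1 := ler_wpM2l (ltW C10) (ec _ c'1).
  have h2 := ler_wpM2l (ltW C20) (ec _ c'2).
  have h3 : 0 <= expR (c' * n0%:R) * expR (- (c' * n%:R)) by rewrite mulr_ge0 ?expR_ge0.
  lra.
move=> w /not_orP[nS nT] ell.
have {HT} low := HT w nT ell (leq_trans (leq_maxr _ _) n0n).
have n1n := leq_trans (leq_maxl _ _) n0n.
move/negP: nS; rewrite -leNgt => occw.
have [lam0|lam0] := ltP 0 lam.
  rewrite lam0 in occw.
  have := HM w (fun i => `[< untight lam L e N M (shift (spaced 0 1 i) w) >]) n n1n ell.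
  rewrite gtr0_norm//; apply => // i /asboolPn/untight_shift; rewrite /spaced muln1 add0r.
  by move=> H k /H.
rewrite ltNge lam0 /= -occ_oppz in occw.
have lamneg : lam < 0 by rewrite lt_neqAle lamN0.
have := HM (reflect_env w) (fun i => `[< untight lam L e N M (shift (- i%:Z) w) >])
  n n1n (elliptic_reflect ell).
rewrite ltr0_norm// tight_reflect oppr0; apply => //.
  by move=> i /asboolPn/untight_shift H k /H; rewrite tight_reflect.
by rewrite mgf_reflect oppr0.
Qed.

End decay.

(** * Deviation inequality for the quenched exponential moments *)

Lemma measurable_is_env (R : realType) : measurable [set w : env_space R | is_env w].
Proof.
rewrite [X in measurable X](_ : _ = ~` \bigcup_(x : int) [set w : env_space R | ~ `]0, 1[%classic (w x)]).
  apply: measurableC; apply: countable_bigcupT_measurable => [|x]; first exact: countableP.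
  have mB : measurable (~` `]0, 1[%classic : set (measurableTypeR R)).
    by apply: measurableC; exact: measurable_itv.
  exact: (measurable_site x mB).
apply/seteqP; split => [w w01 [x _] /=|w nw x]; first by rewrite in_itv /=; exact.
by apply: contrapT => wx; apply: nw; exists x => //=; rewrite in_itv.
Qed.

Theorem theorem4 (R : realType)
    (alpha : probability (measurableTypeR R) R)
    (mu : probability (env_space R) R)
    (mu_basic : basic alpha mu)
    (P : env_space R -> probability path_space R)
    (P_quenched : forall omega, is_env omega -> quenched_law omega (P omega))
    (I : R -> \bar R)
    (I_rate : quenched_rate_function mu P I)
    (lambda delta eps : R) (delta01 : 0 < delta < 1) (eps_gt0 : 0 < eps) :
  exists C c : R, [/\ 0 < C, 0 < c &
    forall n : nat, (0 < n)%N ->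
      (mu [set omega | is_env omega /\
             eps%:E < `| log_mgf_rate (P omega) lambda n - legendre I lambda |]
        <= (C * expR (- (c * (n%:R `^ (1 - delta)))))%:E)%E].
Proof.
have [_ mulaw [c c0 supp_c] _] := mu_basic.
have [q q01 trap0] := basic_trap mu_basic.
have ell_ae := negligible_setC_elliptic mulaw supp_c.
have [I0 _ LDP_ae] := I_rate.
have bad_ae : mu.-negligible (~` elliptic c `|` ~` [set w | LDP (velocity_law (P w)) I]).
  exact: negligibleU.
have varw w : ~ (~` elliptic c `|` ~` [set w | LDP (velocity_law (P w)) I]) w ->
    exists2 L : R, legendre I lambda = L%:E &
    forall e, 0 < e -> \forall n \near \oo, tight w lambda L e n 0.
  move=> /not_orP[/contrapT ell /contrapT LP].
  have w01 := elliptic_is_env c0 ell.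
  exact: varadhan w01 (P_quenched _ w01) LP I0.
(* One good environment shows that the Legendre transform, which does not depend on the environment,
   is finite. *)
have [L EL] : exists L : R, legendre I lambda = L%:E.
  have [|w [/varw[L EL _] _]] := negligible_avoid (B := set0) bad_ae measurable0.
    by rewrite measure0.
  by exists L.
have tight_ae : mu.-negligible
    [set w | ~ forall e, 0 < e -> \forall n \near \oo, tight w lambda L e n 0].
  apply: negligibleS bad_ae => w nw; apply: contrapT => /varw[L'].
  by rewrite EL => -[<-].
have decay : exists C c' : R, [/\ 0 < C, 0 < c' & forall n, exists T : set (env_space R),
    [/\ measurable T, (mu T <= (C * expR (- (c' * n%:R)))%:E)%E &
     forall w, ~ T w -> elliptic c w -> tight w lambda L eps n 0]].
  have [lam0|lam0] := eqVneq lambda 0; last first.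
    have e4 : 0 < eps / 4 by rewrite divr_gt0.
    have [C [c' [C0 c'0 H]]] := tight_decay mulaw lam0 e4 c0 q01 trap0 ell_ae tight_ae.
    exists C, c'; split => // n; have [T [mT Tle HT]] := H n; exists T; split => //.
    by move=> w nT ell; have := HT w nT ell; rewrite mulrC divfK ?pnatr_eq0.
  (* For [lambda = 0] the expectation is [1]; tightness in one environment then gives [|L| <= eps],
     which settles all environments and times. *)
  have mgf1 (w : env_space R) n : mgf w lambda n 0 = 1.
    rewrite -[RHS](iter_step_cst w _ n 0) /mgf lam0.
    by congr (iter n _ _ _); apply/funext => y; rewrite mul0r expR0.
  exists 1, 1; split => // n; exists set0; split.
  - exact: measurable0.
  - by rewrite measure0 lee_fin mul1r expR_ge0.
  move=> w _ _; have [|w' [/contrapT/(_ eps eps_gt0)[N _ HN] _]] :=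
    negligible_avoid (B := set0) tight_ae measurable0; first by rewrite measure0.
  have := HN N.+1 (leqnSn N); rewrite /tight !mgf1 -expR0 !ler_expR.
  rewrite pmulr_lle0 ?ltr0n// pmulr_lge0 ?ltr0n// => /andP[h1 h2].
  by rewrite mulr_le0_ge0// mulr_ge0.
have [C [c' [C0 c'0 H]]] := decay.
exists C, c'; split => // n n0.
have n0R : (0 < n%:R :> R) by rewrite ltr0n.
have [T [mT Tle HT]] := H n.
set S := [set w | _].
have SE : S = [set w | is_env w] `&`
    ~` [set w : env_space R | `|ln (mgf w lambda n 0) / n%:R - L| <= eps].
  apply/seteqP; split => [w [w01]|w [w01 /negP]].
    rewrite (log_mgf_rateE _ _ w01 (P_quenched _ w01)) EL -EFinB lte_fin => h.
    by split => //=; apply/negP; rewrite -ltNge.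
  rewrite -ltNge => h; split => //.
  by rewrite (log_mgf_rateE _ _ w01 (P_quenched _ w01)) EL -EFinB lte_fin.
have mS : measurable S.
  rewrite SE; apply: measurableI; first exact: measurable_is_env.
  apply: measurableC; apply: measurable_le_set => //.
  apply: measurableT_comp => //; apply: measurable_funB => //.
  apply: measurable_funM => //; apply: measurableT_comp; first exact: measurable_ln.
  exact: measurable_mgf.
have [Nl [mNl Nl0 NlE]] := ell_ae.
have ST : S `<=` Nl `|` T.
  move=> w; rewrite SE => -[w01 /= nw]; apply: contrapT => /not_orP[nNl nT].
  have ell : elliptic c w by apply: contrapT => /NlE.
  apply: nw; have := HT w nT ell; rewrite /tight => /andP[lo hi].
  have m0 := mgf_gt0 lambda n 0 w01.
  have {lo} : L - eps <= ln (mgf w lambda n 0) / n%:R.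
    by rewrite ler_pdivlMr// -ler_expR lnK.
  have {hi} : ln (mgf w lambda n 0) / n%:R <= L + eps.
    by rewrite ler_pdivrMr// -ler_expR lnK.
  by rewrite ler_norml; lra.
apply: (@le_trans _ _ (mu (Nl `|` T))).
  by apply: le_measure; rewrite ?inE//; exact: measurableU.
apply: le_trans (measureU2 _ mNl mT) _.
rewrite [X in (X + _)%E](_ : _ = 0%E)// add0e; apply: le_trans Tle _.
(* The decay obtained is exponential in [n], and the power [1 - delta] of [n] is at most [n], as
   [n >= 1]. *)
rewrite lee_fin ler_pM2l// ler_expR lerN2 ler_pM2l//.
rewrite -[leRHS]powRr1 ?ler0n// ler_powR ?ler1n//.
by rewrite gerBl ltW//; case/andP: delta01.
Qed.
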